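(* Let $K$ be an algebraically closed field of arbitrary characteristic, and let $f,g\in K[[x_1,\dots,x_n]]$ be such that $\mathrm{ord}(f)=s\ge 2$ and $\tau(f)<\infty$. Then the following are equivalent: (i) $f$ and $g$ are contact equivalent. (ii) $T_k(f)\cong T_k(g)$ as $K$-algebras for some (equivalently, for all) $k\in\mathbb{N}$ such that $$\mathfrak{m}^{\left\lfloor \frac{k+2s}{2}\right\rfloor}\subset \mathfrak{m}\langle f\rangle+\mathfrak{m}^2\,\mathrm{j}(f).$$
   Context: $K[[\mathbf{x}]]=K[[x_1,\dots,x_n]]$ is the formal power series ring over $K$ with maximal ideal $\mathfrak{m}$; $\mathbb{N}$ includes $0$. For $h\in K[[\mathbf{x}]]$: the Jacobian ideal is $\mathrm{j}(h)=\langle \partial h/\partial x_1,\dots,\partial h/\partial x_n\rangle$; the Tjurina ideal is $\mathrm{tj}(h)=\langle h,\partial h/\partial x_1,\dots,\partial h/\partial x_n\rangle$; the Tjurina algebra is $T(h)=K[[\mathbf{x}]]/\mathrm{tj}(h)$; the Tjurina number is $\tau(h)=\dim_K T(h)$. For $k\in\mathbb{N}$, the $k$-th Tjurina algebra is $T_k(h)=K[[\mathbf{x}]]/\langle h,\mathfrak{m}^k\mathrm{j}(h)\rangle$. The order $\mathrm{ord}(h)$ is the maximal $l$ with $h\in\mathfrak{m}^l$. Two power series $f,g$ are contact equivalent if there are a $K$-algebra automorphism $\varphi$ of $K[[\mathbf{x}]]$ and a unit $u\in K[[\mathbf{x}]]^*$ with $g=u\varphi(f)$. $\lfloor\cdot\rfloor$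 denotes the floor (the largest integer not exceeding the argument). *)

(* Defs.v *)
From HB Require Import structures.
From mathcomp Require Import all_boot all_order all_algebra.
From mathcomp Require Import generic_quotient ring_quotient mpoly.
From mathcomp Require Import boolp classical_sets.

Set Implicit Arguments.
Unset Strict Implicit.
Unset Printing Implicit Defensive.

Import GRing.Theory.
Local Open Scope ring_scope.
Local Open Scope quotient_scope.

Record mfps (R : Type) (n : nat) := MFPS { mfcoef : 'X_{1..n} -> R }.

Notation "{ 'mfps' R [ n ] }" := (mfps R n)
  (at level 0, R at level 2, n at level 2, format "{ 'mfps'  R [ n ] }")
  : type_scope.

HB.instance Definition _ (R : Type) n := gen_eqMixin {mfps R[n]}.
HB.instance Definition _ (R : Type) n := gen_choiceMixin {mfps R[n]}.

Lemma mfpsP (R : Type) n (f g : {mfps R[n]}) :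
  mfcoef f =1 mfcoef g -> f = g.
Proof. by case: f g => [f] [g] /= /funext ->. Qed.

Section PowerSeriesRing.
Variables (R : comNzRingType) (n : nat).
Implicit Types (f g h : {mfps R[n]}) (m : 'X_{1..n}).

Definition mfps_zero : {mfps R[n]} := MFPS (fun _ => 0).
Definition mfps_opp f : {mfps R[n]} := MFPS (fun m => - mfcoef f m).
Definition mfps_add f g : {mfps R[n]} :=
  MFPS (fun m => mfcoef f m + mfcoef g m).
Definition mfps_scale (a : R) f : {mfps R[n]} := MFPS (fun m => a * mfcoef f m).
Definition mfps_one : {mfps R[n]} := MFPS (fun m => (m == 0%MM)%:R).
(* The bound on the degrees only serves to make the index type finite. *)
Definition mfps_mul f g : {mfps R[n]} :=
  MFPS (fun m => \sum_(k : 'X_{1..n < (mdeg m).+1, (mdeg m).+1}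
                        | m == (k.1 + k.2)%MM) mfcoef f k.1 * mfcoef g k.2).

Fact mfps_addA : associative mfps_add.
Proof. by move=> f g h; apply/mfpsP => m; apply: addrA. Qed.
Fact mfps_addC : commutative mfps_add.
Proof. by move=> f g; apply/mfpsP => m; apply: addrC. Qed.
Fact mfps_add0 : left_id mfps_zero mfps_add.
Proof. by move=> f; apply/mfpsP => m; apply: add0r. Qed.
Fact mfps_addN : left_inverse mfps_zero mfps_opp mfps_add.
Proof. by move=> f; apply/mfpsP => m; apply: addNr. Qed.

HB.instance Definition _ := GRing.isZmodule.Build {mfps R[n]}
  mfps_addA mfps_addC mfps_add0 mfps_addN.

Definition mfps_agree (d : nat) f (p : {mpoly R[n]}) :=
  forall m, (mdeg m <= d)%N -> mfcoef f m = p@_m.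

Lemma mfps_mulE f g m p q :
  mfps_agree (mdeg m) f p -> mfps_agree (mdeg m) g q ->
  mfcoef (mfps_mul f g) m = (p * q)@_m.
Proof.
move=> fp gq; rewrite mcoeffM /=; apply: eq_bigr => -[k1 k2] _ /=.
by rewrite fp ?gq // -ltnS ?bmdeg.
Qed.

Definition mfps_trunc (d : nat) f : {mpoly R[n]} :=
  \sum_(m : 'X_{1..n < d.+1}) mfcoef f m *: 'X_[m].

Lemma mfps_truncP d f : mfps_agree d f (mfps_trunc d f).
Proof.
move=> m; rewrite -ltnS => md; rewrite /mfps_trunc raddf_sum /=.
rewrite (bigD1 (BMultinom md)) //= mcoeffZ mcoeffX eqxx mulr1 big1 ?addr0 //.
move=> k /eqP nk; rewrite mcoeffZ mcoeffX; case: eqP => [e|]; last by rewrite mulr0.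
by case: nk; apply: val_inj.
Qed.

Lemma mfps_agreeW d e f p : (e <= d)%N -> mfps_agree d f p -> mfps_agree e f p.
Proof. by move=> ed fp m me; apply: fp; apply: leq_trans ed. Qed.

Lemma mfps_agreeM d f g p q : mfps_agree d f p -> mfps_agree d g q ->
  mfps_agree d (mfps_mul f g) (p * q).
Proof. by move=> fp gq m md; apply: mfps_mulE; apply: mfps_agreeW md _. Qed.

Fact mfps_mulA : associative mfps_mul.
Proof.
move=> f g h; apply/mfpsP => m; have T := @mfps_truncP (mdeg m).
rewrite (mfps_mulE (T f) (mfps_agreeM (T g) (T h))).
by rewrite (mfps_mulE (mfps_agreeM (T f) (T g)) (T h)) mulrA.
Qed.

Fact mfps_mulC : commutative mfps_mul.
Proof.
move=> f g; apply/mfpsP => m; have T := @mfps_truncP (mdeg m).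
by rewrite (mfps_mulE (T f) (T g)) (mfps_mulE (T g) (T f)) mulrC.
Qed.

Fact mfps_mul1 : left_id mfps_one mfps_mul.
Proof.
move=> f; apply/mfpsP => m; have T := @mfps_truncP (mdeg m).
rewrite (@mfps_mulE _ _ _ 1 _ _ (T f)) ?mul1r ?T //.
by move=> k _; rewrite mcoeff1.
Qed.

Fact mfps_mulD : left_distributive mfps_mul mfps_add.
Proof.
move=> f g h; apply/mfpsP => m /=; rewrite -big_split /=.
by apply: eq_bigr => k _; rewrite mulrDl.
Qed.

Fact mfps_one_neq0 : mfps_one != 0.
Proof.
by apply/eqP => /(congr1 (fun f => mfcoef f 0%MM)) /eqP; rewrite /= eqxx oner_eq0.
Qed.

HB.instance Definition _ := GRing.Zmodule_isComNzRing.Build {mfps R[n]}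
  mfps_mulA mfps_mulC mfps_mul1 mfps_mulD mfps_one_neq0.

Fact mfps_scaleA a b f : mfps_scale a (mfps_scale b f) = mfps_scale (a * b) f.
Proof. by apply/mfpsP => m; apply: mulrA. Qed.
Fact mfps_scale1 : left_id 1 mfps_scale.
Proof. by move=> f; apply/mfpsP => m; apply: mul1r. Qed.
Fact mfps_scaleDr : right_distributive mfps_scale +%R.
Proof. by move=> a f g; apply/mfpsP => m; apply: mulrDr. Qed.
Fact mfps_scaleDl f : {morph mfps_scale^~ f : a b / a + b}.
Proof. by move=> a b; apply/mfpsP => m; apply: mulrDl. Qed.

HB.instance Definition _ := GRing.Zmodule_isLmodule.Build R {mfps R[n]}
  mfps_scaleA mfps_scale1 mfps_scaleDr mfps_scaleDl.

Fact mfps_scaleAl (a : R) f g : a *: (f * g) = (a *: f) * g.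
Proof.
apply/mfpsP => m /=; rewrite mulr_sumr.
by apply: eq_bigr => k _; rewrite mulrA.
Qed.

HB.instance Definition _ :=
  GRing.Lmodule_isLalgebra.Build R {mfps R[n]} mfps_scaleAl.
HB.instance Definition _ := GRing.Lalgebra_isComAlgebra.Build R {mfps R[n]}.

Definition mfps_unit : {pred {mfps R[n]}} := fun f => `[< exists g, g * f = 1 >].
Definition mfps_inv f : {mfps R[n]} :=
  if pselect (exists g, g * f = 1) is left fU then projT1 (cid fU) else f.

Fact mfps_mulV : {in mfps_unit, left_inverse 1 mfps_inv *%R}.
Proof.
move=> f /asboolP fU; rewrite /mfps_inv; case: pselect => // fU'.
exact: projT2 (cid fU').
Qed.
Fact mfps_unitP f g : g * f = 1 -> mfps_unit f.
Proof. by move=> gf; apply/asboolP; exists g. Qed.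
Fact mfps_inv_out : {in [predC mfps_unit], mfps_inv =1 id}.
Proof.
move=> f fU; rewrite /mfps_inv; case: pselect => // fU'.
by case/negP: fU; apply/asboolP.
Qed.

HB.instance Definition _ := GRing.ComNzRing_hasMulInverse.Build {mfps R[n]}
  mfps_mulV mfps_unitP mfps_inv_out.

Definition mfps_var (i : 'I_n) : {mfps R[n]} := MFPS (fun m => (m == U_(i)%MM)%:R).

Definition mfps_deriv (i : 'I_n) f : {mfps R[n]} :=
  MFPS (fun m => mfcoef f (m + U_(i))%MM *+ (m i).+1).

End PowerSeriesRing.

Section Ideals.
Variable A : comNzRingType.

Definition is_ideal (I : set A) : Prop :=
  [/\ I 0, forall x y, I x -> I y -> I (x + y) & forall a x, I x -> I (a * x)].

Record ideal := Ideal { ideal_set :> set A; idealP : is_ideal ideal_set }.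

Fact is_ideal_gen (S : set A) : is_ideal (smallest is_ideal S).
Proof.
split=> [I [[]]//|x y Sx Sy I [/[dup] iI [_ iD _] SI]|a x Sx I [/[dup] iI [_ _ iM] SI]].
  by apply: iD; [apply: Sx|apply: Sy].
by apply: iM; apply: Sx.
Qed.
Definition ideal_gen (S : set A) : ideal := Ideal (is_ideal_gen S).

Fact is_ideal_one : is_ideal [set: A]. Proof. by []. Qed.
Definition ideal_one : ideal := Ideal is_ideal_one.

Fact is_ideal_add (I J : ideal) : is_ideal [set x + y | x in I & y in J]%classic.
Proof.
case: I J => [I [I0 ID IM]] [J [J0 JD JM]]; split=> /=.
- by exists 0 => //; exists 0 => //; rewrite addr0.
- move=> _ _ [x1 Ix1 [y1 Jy1 <-]] [x2 Ix2 [y2 Jy2 <-]].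
  exists (x1 + x2); first exact: ID.
  by exists (y1 + y2); [exact: JD|rewrite addrACA].
- move=> a _ [x Ix [y Jy <-]]; exists (a * x); first exact: IM.
  by exists (a * y); [exact: JM|rewrite mulrDr].
Qed.
Definition ideal_add (I J : ideal) : ideal := Ideal (is_ideal_add I J).

Definition ideal_mul (I J : ideal) : ideal :=
  ideal_gen [set x * y | x in I & y in J]%classic.

Definition ideal_exp (I : ideal) (k : nat) : ideal :=
  iter k (ideal_mul I) ideal_one.

End Ideals.

(* {ideal_quot I} from ring_quotient requires a proper ideal. Here I may be the
   whole ring (as happens for <h, m^k j(h)> when h is a unit), so the quotient
   is only a comPzRingType and an lmodType. *)

Section IdealQuotient.
Variables (K : comNzRingType) (A : comAlgType K) (I : ideal A).

Definition ideal_pred : {pred A} := fun x => `[< ideal_set I x >].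

Fact ideal_pred_zmod : zmod_closed ideal_pred.
Proof.
case: (idealP I) => I0 ID IM.
split=> [|x y /asboolP Ix /asboolP Iy]; apply/asboolP => //.
by apply: ID => //; rewrite -mulN1r; apply: IM.
Qed.
HB.instance Definition _ := GRing.isZmodClosed.Build A ideal_pred ideal_pred_zmod.

Definition idquot : Type := @Quotient.quot A ideal_pred.
HB.instance Definition _ := GRing.Zmodule.on idquot.

Definition idquot_pi (x : A) : idquot := \pi_(@Quotient.quot A ideal_pred) x.
Definition idquot_repr (q : idquot) : A := repr (q : @Quotient.quot A ideal_pred).

Lemma idquot_reprK q : idquot_pi (idquot_repr q) = q.
Proof. exact: reprK. Qed.

Lemma idquot_eqP x y : idquot_pi x = idquot_pi y <-> ideal_set I (x - y).
Proof.
split=> [/eqP|Ixy]; first by rewrite -Quotient.idealrBE => /asboolP.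
by apply/eqP; rewrite -Quotient.idealrBE; apply/asboolP.
Qed.

Fact idquot_pi_zmod : zmod_morphism idquot_pi.
Proof. exact: pi_is_zmod_morphism. Qed.
HB.instance Definition _ :=
  GRing.isZmodMorphism.Build A idquot idquot_pi idquot_pi_zmod.

Definition idquot_one : idquot := idquot_pi 1.
Definition idquot_mul (p q : idquot) : idquot :=
  idquot_pi (idquot_repr p * idquot_repr q).
Definition idquot_scale (a : K) (q : idquot) : idquot :=
  idquot_pi (a *: idquot_repr q).

Lemma idquot_piM x y : idquot_pi (x * y) = idquot_mul (idquot_pi x) (idquot_pi y).
Proof.
set x' := idquot_repr (idquot_pi x); set y' := idquot_repr (idquot_pi y).
have Ix : ideal_set I (x - x') by apply/idquot_eqP; rewrite idquot_reprK.
have Iy : ideal_set I (y - y') by apply/idquot_eqP; rewrite idquot_reprK.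
apply/idquot_eqP; case: (idealP I) => _ ID IM.
rewrite -[x * y](addrNK (x * y')) -mulrBr -addrA -mulrBl.
by apply: ID; [|rewrite mulrC]; apply: IM.
Qed.

Lemma idquot_piZ a x : idquot_pi (a *: x) = idquot_scale a (idquot_pi x).
Proof.
have Ix : ideal_set I (x - idquot_repr (idquot_pi x)).
  by apply/idquot_eqP; rewrite idquot_reprK.
apply/idquot_eqP; case: (idealP I) => _ _ IM.
by rewrite -scalerBr -[_ - _]mul1r scalerAl; apply: IM.
Qed.

Fact idquot_mulA : associative idquot_mul.
Proof.
move=> p q r; rewrite -[p]idquot_reprK -[q]idquot_reprK -[r]idquot_reprK.
by rewrite -!idquot_piM mulrA.
Qed.
Fact idquot_mulC : commutative idquot_mul.
Proof. by move=> p q; rewrite /idquot_mul mulrC. Qed.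
Fact idquot_mul1 : left_id idquot_one idquot_mul.
Proof. by move=> p; rewrite -[p]idquot_reprK -idquot_piM mul1r. Qed.
Fact idquot_mulDl : left_distributive idquot_mul +%R.
Proof.
move=> p q r; rewrite -[p]idquot_reprK -[q]idquot_reprK -[r]idquot_reprK.
by rewrite -raddfD -!idquot_piM mulrDl raddfD.
Qed.
HB.instance Definition _ := GRing.Zmodule_isComPzRing.Build idquot
  idquot_mulA idquot_mulC idquot_mul1 idquot_mulDl.

Fact idquot_scaleA a b q :
  idquot_scale a (idquot_scale b q) = idquot_scale (a * b) q.
Proof. by rewrite -[q]idquot_reprK -!idquot_piZ scalerA. Qed.
Fact idquot_scale1 : left_id 1 idquot_scale.
Proof. by move=> q; rewrite -[q]idquot_reprK -idquot_piZ scale1r. Qed.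
Fact idquot_scaleDr : right_distributive idquot_scale +%R.
Proof.
move=> a p q; rewrite -[p]idquot_reprK -[q]idquot_reprK.
by rewrite -raddfD -!idquot_piZ scalerDr raddfD.
Qed.
Fact idquot_scaleDl q : {morph idquot_scale^~ q : a b / a + b}.
Proof.
by move=> a b; rewrite -[q]idquot_reprK -!idquot_piZ scalerDl raddfD.
Qed.
HB.instance Definition _ := GRing.Zmodule_isLmodule.Build K idquot
  idquot_scaleA idquot_scale1 idquot_scaleDr idquot_scaleDl.

Fact idquot_pi_monoid : monoid_morphism idquot_pi.
Proof. by split=> // x y; rewrite idquot_piM. Qed.
HB.instance Definition _ :=
  GRing.isMonoidMorphism.Build A idquot idquot_pi idquot_pi_monoid.
HB.instance Definition _ :=
  GRing.isScalable.Build K A idquot *:%R idquot_pi idquot_piZ.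

Lemma idquot_scaleAl (a : K) (p q : idquot) : a *: (p * q) = (a *: p) * q.
Proof.
have piM x y : idquot_pi x * idquot_pi y = idquot_pi (x * y).
  by rewrite idquot_piM.
have piZ x : a *: idquot_pi x = idquot_pi (a *: x) by rewrite idquot_piZ.
by rewrite -[p]idquot_reprK -[q]idquot_reprK piM !piZ piM scalerAl.
Qed.

End IdealQuotient.

(* Isomorphism of K-algebras; {lrmorphism _ -> _} would require the source to be
   a nonzero ring. *)
Definition idquot_isom (K : comNzRingType) (A B : comAlgType K)
    (I : ideal A) (J : ideal B) : Prop :=
  exists2 phi : {rmorphism idquot I -> idquot J}, scalable phi & bijective phi.

Definition has_dim (K : fieldType) (V : lmodType K) (d : nat) : Prop :=
  exists e : 'I_d -> V,
    forall v : V, exists! c : 'rV[K]_d, v = \sum_(i < d) c 0 i *: e i.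

Section Tjurina.
Variables (K : fieldType) (n : nat).
Implicit Types f g h : {mfps K[n]}.

Definition max_ideal : ideal {mfps K[n]} := ideal_gen (range (@mfps_var K n)).

Definition partials h : set {mfps K[n]} := range (fun i => mfps_deriv i h).

Definition jacobian_ideal h : ideal {mfps K[n]} := ideal_gen (partials h).

Definition tjurina_ideal h : ideal {mfps K[n]} :=
  ideal_gen ([set h] `|` partials h)%classic.

Definition tjurina_algebra h : Type := idquot (tjurina_ideal h).
HB.instance Definition _ h := GRing.ComPzRing.on (tjurina_algebra h).
HB.instance Definition _ h := GRing.Lmodule.on (tjurina_algebra h).

Definition tjurina_number_is h (d : nat) : Prop := has_dim (tjurina_algebra h) d.

Definition tjurina_finite h : Prop := exists d, tjurina_number_is h d.

Definition higher_tjurina_ideal (k : nat) h : ideal {mfps K[n]} :=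
  ideal_gen ([set h] `|` ideal_mul (ideal_exp max_ideal k) (jacobian_ideal h))%classic.

Definition higher_tjurina_isom (k : nat) f g : Prop :=
  idquot_isom (higher_tjurina_ideal k f) (higher_tjurina_ideal k g).

Definition ord_is h (l : nat) : Prop :=
  ideal_set (ideal_exp max_ideal l) h /\
  forall l', ideal_set (ideal_exp max_ideal l') h -> (l' <= l)%N.

Definition contact_equivalent f g : Prop :=
  exists (phi : {lrmorphism {mfps K[n]} -> {mfps K[n]}}) (u : {mfps K[n]}),
    [/\ bijective phi, u \is a GRing.unit & g = u * phi f].

Definition determinacy_bound f (s k : nat) : Prop :=
  (ideal_exp max_ideal ((k + 2 * s) %/ 2)
     `<=` ideal_add (ideal_mul max_ideal (ideal_gen [set f]))
                    (ideal_mul (ideal_exp max_ideal 2) (jacobian_ideal f)))%classic.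

End Tjurina.

(* Main.v *)
Require Import Defs.
From HB Require Import structures.
From mathcomp Require Import all_boot all_order all_algebra mpoly.
From mathcomp Require Import boolp classical_sets ring.

(** The equivalence rests on three facts about power series over a field, none
    of which depends on the characteristic.

    Contact equivalence preserves the higher Tjurina ideals: by the chain rule an
    automorphism carries the ideal of [f] to that of its image ([tj_span_auto]),
    and by the product rule a unit factor does not change it ([tj_span_unit]).
    This gives the isomorphisms for all [k].  A suitable [k] exists because a
    finite Tjurina number forces every variable to be nilpotent modulo the
    Tjurina ideal, which therefore contains a power of the maximal ideal
    ([determinacy_bound_exists]).

    Conversely, an isomorphism of the [k]-th Tjurina algebras lifts to an
    automorphism of the power series ring ([quotient_isom_lift]): both ideals
    contain a power of the maximal ideal, so the isomorphism is given by a
    substitution, and the ideal of [f] has order at least 2, so the substitution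
    is invertible on the cotangent space.  After applying this automorphism to
    [f], the two series have the same ideal, and comparing orders shows that [g]
    is a unit times [f] plus a perturbation of order at least [k + s - 1].

    Such a perturbation does not change the contact class ([finite_determinacy]).
    The inclusion of the power of the maximal ideal with exponent
    [(k + 2 * s) %/ 2] in the ideal spanned by [m f] and [m^2 j(f)] lets one
    write the perturbation as [a f + sum_i b_i d_i f] with [a] and [b_i] of
    controlled order; multiplying by [1 + a] and substituting [x_i + b_i] absorbs
    it up to the second-order terms of the Taylor expansion, and the exponent
    makes these of higher order than the perturbation.  Iterating
    and passing to the limit removes it entirely.

    Arguments about infinite series are reduced to one device, the expansion of
    a series as a constant plus a combination of the variables ([var_quotP]),
    iterated modulo arbitrarily high order ([krull_ind]). *)

Set Implicit Arguments.
Unset Strict Implicit.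
Unset Printing Implicit Defensive.

Import GRing.Theory.
Local Open Scope ring_scope.

Local Notation "''x_' i" := (@mfps_var _ _ i)
  (at level 8, i at level 2, format "''x_' i").

(** * The filtration by order and its completeness *)

Section Filtration.
Variables (K : fieldType) (n : nat).
Implicit Types (p q h : {mfps K[n]}) (m : 'X_{1..n}) (i j : 'I_n).

(** This is membership in the [d]-th power of the maximal ideal, see
    [ideal_expE], phrased through coefficients.  It is a record rather than a
    plain definition so that simplification treats it as an atom. *)
Record ord_ge (d : nat) p : Prop :=
  OrdGe { ord_ge_coef : forall m, (mdeg m < d)%N -> mfcoef p m = 0 }.

Lemma ord_geW d e p : (e <= d)%N -> ord_ge d p -> ord_ge e p.
Proof. by move=> ed [pd]; split=> m me; apply: pd; apply: leq_trans ed. Qed.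

Lemma ord_ge0 p : ord_ge 0 p. Proof. by split. Qed.

Lemma ord_ge_zero d : ord_ge d (0 : {mfps K[n]}). Proof. by split. Qed.

Lemma ord_geD d p q : ord_ge d p -> ord_ge d q -> ord_ge d (p + q).
Proof. by move=> [pd] [qd]; split=> m md /=; rewrite pd ?qd ?addr0. Qed.

Lemma ord_geN d p : ord_ge d p -> ord_ge d (- p).
Proof. by move=> [pd]; split=> m md /=; rewrite pd ?oppr0. Qed.

Lemma ord_geB d p q : ord_ge d p -> ord_ge d q -> ord_ge d (p - q).
Proof. by move=> pd qd; apply: ord_geD => //; apply: ord_geN. Qed.

Lemma ord_ge_sum d (I : finType) (F : I -> {mfps K[n]}) :
  (forall k, ord_ge d (F k)) -> ord_ge d (\sum_k F k).
Proof.
by move=> Fd; elim/big_ind: _ => // p q; apply: ord_geD.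
Qed.

Lemma ord_geM d e p q : ord_ge d p -> ord_ge e q -> ord_ge (d + e) (p * q).
Proof.
move=> [pd] [qe]; split=> m md; rewrite /= big1 // => k /eqP mk.
have [kd|dk] := ltnP (mdeg k.1) d; first by rewrite pd ?mul0r.
rewrite qe ?mulr0 // -(ltn_add2l d); apply: leq_ltn_trans md.
by rewrite [leqRHS](congr1 mdeg mk) mdegD leq_add2r.
Qed.

Lemma ord_geMl d p q : ord_ge d q -> ord_ge d (p * q).
Proof. by rewrite -[X in ord_ge X (_ * _)]add0n; apply: ord_geM. Qed.

Lemma ord_geMr d p q : ord_ge d p -> ord_ge d (p * q).
Proof. by rewrite mulrC; apply: ord_geMl. Qed.

Lemma ord_geZ d (a : K) p : ord_ge d p -> ord_ge d (a *: p).
Proof. by rewrite -mulr_algl; apply: ord_geMl. Qed.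

Lemma ord_ge1_coef0 p : mfcoef p 0%MM = 0 -> ord_ge 1 p.
Proof.
by move=> p0; split=> m; rewrite ltnS leqn0 mdeg_eq0 => /eqP->.
Qed.

Lemma ord_ge_var i : ord_ge 1 ('x_i).
Proof.
split=> m m1 /=; case: eqP => // mi.
by move: m1; rewrite mi mdeg1.
Qed.

Lemma ord_ge_eq0 p : (forall d, ord_ge d p) -> p = 0.
Proof. by move=> pd; apply/mfpsP => m; apply: (ord_ge_coef (pd (mdeg m).+1)). Qed.

Lemma mfcoef_sum (I : finType) (F : I -> {mfps K[n]}) m :
  mfcoef (\sum_k F k) m = \sum_k mfcoef (F k) m.
Proof. by elim/big_ind2: _ => // p a q b <- <-. Qed.

Lemma mfcoef_varM i p m :
  mfcoef ('x_i * p) m = if (0 < m i)%N then mfcoef p (m - U_(i))%MM else 0.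
Proof.
have agX : mfps_agree (mdeg m) 'x_i ('X_i : {mpoly K[n]}).
  by move=> k _; rewrite mcoeffX eq_sym.
have T := @mfps_truncP K n (mdeg m).
case: ifP => [mi|/negbT]; last first.
  rewrite -eqn0Ngt => /eqP mi; rewrite /= big1 // => k /eqP mk.
  case: eqP => [kU|]; last by rewrite mul0r.
  by have /= := congr1 (fun m : 'X_{1..n} => m i) mk; rewrite mnmDE kU mnm1E eqxx mi.
have le_m : (U_(i) <= m)%MM.
  by apply/mnm_lepP => j; rewrite mnm1E; case: eqP => // <-.
rewrite [LHS](mfps_mulE agX (T p)) mulrC -{1}[m](submK le_m) addmC mcoeffMX.
by rewrite [RHS](T p) // -{2}[m](submK le_m) mdegD leq_addr.
Qed.

(** To expand a series of positive order as a combination of the variables,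
    every nonconstant monomial has to be assigned to one variable dividing it;
    [var_quot p i] collects what was assigned to the [i]-th one. *)
Definition var_of m : option 'I_n := [pick i | (0 < m i)%N].

Definition var_quot p i : {mfps K[n]} :=
  MFPS (fun m => if var_of (m + U_(i))%MM == Some i then mfcoef p (m + U_(i))%MM
                 else 0).

Lemma var_quot_ge d p i : ord_ge d.+1 p -> ord_ge d (var_quot p i).
Proof.
by move=> [pd]; split=> m md /=; case: ifP => // _; apply: pd; rewrite mdegD mdeg1 addn1.
Qed.

Lemma var_quotP p : p = (mfcoef p 0%MM)%:A + \sum_i 'x_i * var_quot p i.
Proof.
apply/mfpsP => m /=; rewrite mfcoef_sum.
under eq_bigr do rewrite mfcoef_varM /=.
rewrite /var_of; have [->|nm] := eqVneq m 0%MM.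
  rewrite mulr1 big1 ?addr0 // => i _; by rewrite mnm0E.
rewrite mulr0 add0r.
have E i : (0 < m i)%N -> (m - U_(i) + U_(i))%MM = m.
  move=> mi; apply: submK; apply/mnm_lepP => j; rewrite mnm1E.
  by case: eqP => // <-.
have [i mi Pi] : exists2 i, (0 < m i)%N & [pick i | (0 < m i)%N] = Some i.
  case: pickP => [i mi|m0]; first by exists i.
  case/eqP: nm; apply/mnmP => i; rewrite mnm0E; apply/eqP.
  by rewrite eqn0Ngt m0.
rewrite (bigD1 i) //= mi E // Pi eqxx big1 ?addr0 // => j ji.
case: ifP => // mj; rewrite E // Pi; case: eqP => // -[] ij.
by rewrite ij eqxx in ji.
Qed.

Lemma var_quot_ge1 p : ord_ge 1 p -> p = \sum_i 'x_i * var_quot p i.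
Proof.
by move=> [p1]; rewrite {1}(var_quotP p) p1 ?mdeg0 // scale0r add0r.
Qed.

Lemma ord_geP d p :
  ord_ge d.+1 p <-> exists2 q : 'I_n -> {mfps K[n]},
    forall i, ord_ge d (q i) & p = \sum_i 'x_i * q i.
Proof.
split=> [pd|[q qd ->]].
  exists (var_quot p); first by move=> i; apply: var_quot_ge.
  by apply: var_quot_ge1; apply: ord_geW pd.
by apply: ord_ge_sum => i; rewrite -add1n; apply: ord_geM => //; apply: ord_ge_var.
Qed.

Lemma max_idealE p : ideal_set (max_ideal K n) p <-> ord_ge 1 p.
Proof.
split=> [|p1].
  move=> /(_ (ord_ge 1)); apply; split; last by move=> _ [i _ <-]; apply: ord_ge_var.
  split; [exact: ord_ge_zero|exact: ord_geD|by move=> a q; apply: ord_geMl].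
rewrite (var_quot_ge1 p1); case: (idealP (max_ideal K n)) => I0 ID IM.
elim/big_ind: _ => // i _; rewrite mulrC; apply: IM => I [_]; apply.
by exists i.
Qed.

Lemma ideal_expE d p : ideal_set (ideal_exp (max_ideal K n) d) p <-> ord_ge d p.
Proof.
elim: d p => [|d IH] p; first by split=> // _; apply: ord_ge0.
rewrite [ideal_exp _ _]/=; split=> [|pd].
  move=> /(_ (ord_ge d.+1)); apply; split.
    split; [exact: ord_ge_zero|exact: ord_geD|by move=> a q; apply: ord_geMl].
  move=> _ [x /max_idealE x1 [y /IH yd <-]]; rewrite -add1n; exact: ord_geM.
have -> := var_quot_ge1 (ord_geW (ltn0Sn d) pd).
case: (idealP (ideal_mul (max_ideal K n) (ideal_exp (max_ideal K n) d))) => I0 ID IM.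
elim/big_ind: _ => // i _ I [_]; apply; exists 'x_i.
  by apply/max_idealE; apply: ord_ge_var.
by exists (var_quot p i) => //; apply/IH; apply: var_quot_ge.
Qed.

(** The induction used for all identities between operators on power series.
    Expanding an argument along the variables gains one order at each round,
    so a property known for products with a variable propagates to every
    series, modulo any power of the maximal ideal; this replaces density of the
    polynomials together with continuity. *)
Lemma krull_ind (D : {mfps K[n]} -> {mfps K[n]}) (e : nat) :
  zmod_morphism D -> (forall c : K, D c%:A = 0) ->
  (forall d, (d < e)%N -> (forall p, ord_ge d (D p)) ->
     forall i p, ord_ge d.+1 (D ('x_i * p))) ->
  forall p, ord_ge e (D p).
Proof.
move=> DB DC Dx; elim: e Dx => [|e IH] Dx p; first exact: ord_ge0.
have D0 : D 0 = 0 by have := DC 0; rewrite scale0r.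
have DD a b : D (a + b) = D a + D b.
  by rewrite -{1}[b]opprK -[- b]sub0r !DB D0 sub0r opprK.
rewrite (var_quotP p) DD DC add0r (big_morph _ DD D0).
apply: ord_ge_sum => i; apply: (Dx) => // q; apply: IH => d de; apply: Dx.
exact: ltnW.
Qed.

(** Completeness: the coefficients of degree [d] are constant from the
    index [d.+1] on. *)
Lemma limit_exists (a : nat -> {mfps K[n]}) :
  (forall d, ord_ge d (a d.+1 - a d)) -> exists l, forall d, ord_ge d (l - a d).
Proof.
move=> ad; exists (MFPS (fun m => mfcoef (a (mdeg m).+1) m)) => d; split=> m md /=.
rewrite -[d](subnKC md); move: (d - _)%N => {md} e.
elim: e => [|e IH]; first by rewrite addn0 subrr.
apply/eqP; rewrite addnS subr_eq0; move/eqP: IH; rewrite subr_eq0 => /eqP ->.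
rewrite eq_sym -subr_eq0.
by apply/eqP/(ord_ge_coef (ad ((mdeg m).+1 + e)%N)); rewrite addSn ltnS leq_addr.
Qed.

(** Such an operator acts as the identity on the associated graded ring, so it
    is injective because the filtration is separated, and surjective by
    correcting the error one degree at a time.  Both the invertibility of series
    with nonzero constant term and that of automorphisms tangent to the
    identity come from this lemma. *)
Lemma unitri_bij (T : {mfps K[n]} -> {mfps K[n]}) :
  zmod_morphism T -> (forall d p, ord_ge d p -> ord_ge d.+1 (T p - p)) ->
  bijective T.
Proof.
move=> TB Tp; have T0 : T 0 = 0 by rewrite -[0 in LHS](subrr 0) TB subrr.
have injT : injective T.
  move=> p q /eqP; rewrite -subr_eq0 -TB => /eqP Tpq; apply/eqP.
  rewrite -subr_eq0; apply/eqP/ord_ge_eq0; elim=> [|d IH]; first exact: ord_ge0.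
  by move: (Tp _ _ IH); rewrite Tpq sub0r => /ord_geN; rewrite opprK.
have surT q : exists p, T p = q.
  (* T (a d) agrees with q up to order d *)
  pose a := fix a d := if d is e.+1 then a e + (q - T (a e)) else 0.
  have aq d : ord_ge d (q - T (a d)).
    elim: d => [|d IH] /=; first exact: ord_ge0.
    have /ord_geN := Tp _ _ IH.
    rewrite opprB; suff -> : T (a d + (q - T (a d))) = T (a d) + T (q - T (a d)).
      by rewrite opprD addrA.
    by rewrite -{1}[q - _]opprK -[- (q - _)]sub0r !TB T0 sub0r opprK.
  have [|l la] := @limit_exists a; first by move=> d /=; rewrite addrC addKr.
  exists l; apply/eqP; rewrite -subr_eq0; apply/eqP/ord_ge_eq0 => d.
  have -> : T l - q = (T (l - a d) - (l - a d)) + (l - a d) - (q - T (a d)).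
    by rewrite TB; ring.
  apply: ord_geB => //; apply: ord_geD => //.
  exact/(ord_geW (leqnSn d))/Tp.
by exists (fun q => projT1 (cid (surT q))) => [p|q];
  [apply: injT|]; case: (cid _).
Qed.

Lemma unit_of_coef0 p : mfcoef p 0%MM != 0 -> p \is a GRing.unit.
Proof.
move=> p0; pose q := (mfcoef p 0%MM)^-1 *: p.
suff [g _ /(_ 1) qr] : bijective (fun r => q * r).
  move: (g 1) qr => r qr; apply/unitrP; exists ((mfcoef p 0%MM)^-1 *: r).
  rewrite [_ * p]mulrC.
  by rewrite -scalerAr scalerAl qr.
apply: unitri_bij => [a b|d r rd]; first by rewrite mulrBr.
rewrite -{2}[r]mul1r -mulrBl -add1n; apply: ord_geM => //; apply: ord_ge1_coef0.
by rewrite /= mulVf // eqxx subrr.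
Qed.

Lemma nonunit_ord_ge1 p : (p \is a GRing.unit -> False) -> ord_ge 1 p.
Proof.
by move=> pN; apply: ord_ge1_coef0; apply/eqP/negPn/negP => /unit_of_coef0.
Qed.

Lemma ord_ge1_one : ~ ord_ge 1 (1 : {mfps K[n]}).
Proof.
by move=> /ord_ge_coef /(_ 0%MM); rewrite mdeg0 => /(_ isT)/eqP; rewrite /= eqxx oner_eq0.
Qed.
End Filtration.
Arguments ord_ge_var {K n} i.

(** * Substitution of power series *)

Lemma subrACB (V : zmodType) (a b c d : V) : a - b - (c - d) = a - c - (b - d).
Proof. by rewrite !opprB [d - c]addrC addrACA [- b + d]addrC. Qed.

Lemma subrBB (V : zmodType) (c a b : V) : (a - c) - (b - c) = a - b.
Proof. by rewrite subrACB subrr subr0. Qed.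

Lemma mfcoefB (K : fieldType) n (p q : {mfps K[n]}) m :
  mfcoef (p - q) m = mfcoef p m - mfcoef q m.
Proof. by []. Qed.

Section Substitution.
Variables (K : fieldType) (n : nat) (y : 'I_n -> {mfps K[n]}).
Implicit Types (p q : {mfps K[n]}) (P Q : {mpoly K[n]}).

(** Positive order of the [y i] makes evaluation continuous, which is what
    allows passing from polynomials to power series. *)
Lemma polynomial_evaluation : (forall i, ord_ge 1 (y i)) ->
  exists ev : {rmorphism {mpoly K[n]} -> {mfps K[n]}},
  [/\ forall d P, (forall m, (mdeg m < d)%N -> P@_m = 0) -> ord_ge d (ev P),
      scalable ev & forall i, ev 'X_i = y i].
Proof.
move=> y1; exists (mmap (in_alg {mfps K[n]}) y).
split=> [d P Pd|c P|i] /=; last by rewrite mmapX mmap1U.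
  rewrite /mmap; elim/big_ind: _ => [|a b|m _]; first exact: ord_ge_zero.
    exact: ord_geD.
  have [md|dm] := ltnP (mdeg m) d; first by rewrite Pd // rmorph0 mul0r.
  apply/ord_geMl/(ord_geW dm); rewrite /mmap1 mdegE.
  elim/big_ind2: _ => [|a b c e|i _]; [exact: ord_ge0|exact: ord_geM|].
  elim: (m i) => [|k IH]; first exact: ord_ge0.
  by rewrite exprS -add1n; apply: ord_geM.
by rewrite mmapZ /= mulr_algl.
Qed.

Variable ev : {rmorphism {mpoly K[n]} -> {mfps K[n]}}.
Hypothesis ev_ge :
  forall d P, (forall m, (mdeg m < d)%N -> P@_m = 0) -> ord_ge d (ev P).
Hypothesis evZ : scalable ev.
Hypothesis evX : forall i, ev 'X_i = y i.

Definition mfps_subst p : {mfps K[n]} :=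
  MFPS (fun m => mfcoef (ev (mfps_trunc (mdeg m) p)) m).

(** The degree of truncation in [mfps_subst] varies with the coefficient, but
    any polynomial that agrees with [p] far enough gives the same result to the
    same degree. *)
Lemma mfps_subst_agree d p P : mfps_agree d p P ->
  ord_ge d.+1 (mfps_subst p - ev P).
Proof.
move=> pP; split=> m md; rewrite mfcoefB /= -mfcoefB -rmorphB.
apply: (ord_ge_coef (@ev_ge (mdeg m).+1 _ _)) => // k km; rewrite mcoeffB.
by rewrite -(mfps_truncP p) // -pP ?subrr // -ltnS; apply: leq_trans md.
Qed.

Lemma mfps_subst_eq p q :
  (forall d, exists2 P, mfps_agree d p P & ord_ge d.+1 (q - ev P)) ->
  mfps_subst p = q.
Proof.
move=> H; apply/eqP; rewrite -subr_eq0; apply/eqP/ord_ge_eq0 => d.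
have [P pP qP] := H d; apply: (ord_geW (leqnSn d)).
rewrite -[_ - q](subrBB (ev P)); apply: ord_geB => //; exact: mfps_subst_agree.
Qed.

Let T := @mfps_truncP K n.

Fact mfps_subst_additive : zmod_morphism mfps_subst.
Proof.
move=> p q; apply: mfps_subst_eq => d.
exists (mfps_trunc d p - mfps_trunc d q).
  by move=> m md; rewrite mcoeffB -!T.
rewrite raddfB subrACB.
by apply: ord_geB; apply: mfps_subst_agree.
Qed.

Fact mfps_subst_mult : monoid_morphism mfps_subst.
Proof.
split=> [|p q]; apply: mfps_subst_eq => d.
  exists 1; last by rewrite rmorph1 subrr.
  by move=> m _; rewrite mcoeff1.
exists (mfps_trunc d p * mfps_trunc d q); first exact: mfps_agreeM.
rewrite (rmorphM ev) -(subrKA (ev (mfps_trunc d p) * mfps_subst q)) -mulrBl -mulrBr.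
by apply: ord_geD; [apply: ord_geMr|apply: ord_geMl]; apply: mfps_subst_agree.
Qed.

Fact mfps_subst_scalable : scalable mfps_subst.
Proof.
move=> c p; apply: mfps_subst_eq => d; exists (c *: mfps_trunc d p).
  by move=> m md; rewrite mcoeffZ -T.
rewrite evZ -scalerBr; apply: ord_geZ.
exact: mfps_subst_agree.
Qed.

Lemma mfps_subst_var i : mfps_subst 'x_i = y i.
Proof.
apply: mfps_subst_eq => d; exists 'X_i; last by rewrite evX subrr.
by move=> m _; rewrite mcoeffX eq_sym.
Qed.

HB.instance Definition _ := GRing.isZmodMorphism.Build _ _ mfps_subst mfps_subst_additive.
HB.instance Definition _ := GRing.isMonoidMorphism.Build _ _ mfps_subst mfps_subst_mult.
HB.instance Definition _ := GRing.isScalable.Build _ _ _ _ mfps_subst mfps_subst_scalable.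

Definition mfps_subst_lrmorphism : {lrmorphism {mfps K[n]} -> {mfps K[n]}} :=
  mfps_subst.
End Substitution.

Lemma subst_exists (K : fieldType) n (y : 'I_n -> {mfps K[n]}) :
  (forall i, ord_ge 1 (y i)) ->
  exists phi : {lrmorphism {mfps K[n]} -> {mfps K[n]}}, forall i, phi 'x_i = y i.
Proof.
case/polynomial_evaluation => ev [ev_ge evZ evX].
by exists (mfps_subst_lrmorphism ev_ge evZ) => i; apply: mfps_subst_var.
Qed.

(** * Local endomorphisms, partial derivatives and Taylor expansion *)

Section Endomorphisms.
Variables (K : fieldType) (n : nat).
Notation endo := {lrmorphism {mfps K[n]} -> {mfps K[n]}}.
Implicit Types (p q h : {mfps K[n]}) (i j : 'I_n) (phi psi theta : endo).

Lemma endoB phi p q : phi (p - q) = phi p - phi q. Proof. exact: rmorphB. Qed.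
Lemma endoD phi p q : phi (p + q) = phi p + phi q. Proof. exact: rmorphD. Qed.
Lemma endoM phi p q : phi (p * q) = phi p * phi q. Proof. exact: rmorphM. Qed.
Lemma endo0 phi : phi 0 = 0. Proof. exact: rmorph0. Qed.
Lemma endo1 phi : phi 1 = 1. Proof. exact: rmorph1. Qed.
Lemma endo_nat phi k : phi k%:R = k%:R. Proof. exact: rmorph_nat. Qed.
Lemma endo_sum phi (I : finType) (F : I -> {mfps K[n]}) :
  phi (\sum_k F k) = \sum_k phi (F k).
Proof. exact: rmorph_sum. Qed.

Lemma endo_alg phi (c : K) : phi c%:A = c%:A.
Proof. by rewrite linearZ /= endo1. Qed.

Definition local_endo phi := forall i, ord_ge 1 (phi 'x_i).

Lemma local_endo_ge phi d p : local_endo phi -> ord_ge d p -> ord_ge d (phi p).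
Proof.
move=> phi1; elim: d p => [|d IH] p; first by move=> _; apply: ord_ge0.
move=> /ord_geP [q qd ->].
rewrite endo_sum; apply: ord_ge_sum => i; rewrite endoM -add1n.
by apply: ord_geM; [exact: phi1|exact/IH].
Qed.

(** Comparing two endomorphisms on the variables loses no precision: in
    particular the images of the variables determine them. *)
Lemma endo_congr phi psi e p : local_endo phi -> local_endo psi ->
  (forall i, ord_ge e (phi 'x_i - psi 'x_i)) -> ord_ge e (phi p - psi p).
Proof.
move=> phi1 psi1 pe; apply: (@krull_ind _ _ (fun p => phi p - psi p)).
- by move=> a b; rewrite !endoB subrACB.
- by move=> c; rewrite !endo_alg subrr.
move=> d de IH i q; rewrite !endoM.
rewrite -(subrKA (psi 'x_i * phi q)) -mulrBl -mulrBr.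
apply: ord_geD; last by rewrite -add1n; apply: ord_geM; [exact: psi1|].
by apply: ord_geMr; apply: ord_geW de (pe i).
Qed.

(** If the image of a variable were a unit, the variable would be one. *)
Lemma bij_local_endo phi : bijective phi -> local_endo phi.
Proof.
move=> phib i; apply: nonunit_ord_ge1 => /unitrP [q [q1 _]].
have [r rq] : exists r, phi r = q by case: phib => g _ gK; exists (g q).
have rx : r * 'x_i = 1 by apply: (bij_inj phib); rewrite endoM rq endo1.
by apply: (@ord_ge1_one K n); rewrite -rx; apply/ord_geMl/ord_ge_var.
Qed.

Lemma endo_inverse phi : bijective phi ->
  exists psi : endo, [/\ bijective psi, cancel phi psi & cancel psi phi].
Proof.
move=> phib; have [g gK Kg] := phib.
have gB : zmod_morphism g.
  by move=> a b; apply: (bij_inj phib); rewrite endoB !Kg.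
have gM : monoid_morphism g.
  by split=> [|a b]; apply: (bij_inj phib); rewrite ?(endoM, endo1) !Kg.
have gZ : scalable g.
  by move=> a b; apply: (bij_inj phib); rewrite linearZ /= !Kg.
pose g1 := GRing.isZmodMorphism.Build _ _ g gB.
pose g2 := GRing.isMonoidMorphism.Build _ _ g gM.
pose g3 := GRing.isScalable.Build _ _ _ _ g gZ.
pose G : endo := HB.pack g g1 g2 g3.
by exists G; split=> //; exists phi.
Qed.

Lemma mfps_derivB i : zmod_morphism (@mfps_deriv K n i).
Proof. by move=> p q; apply/mfpsP => m; rewrite /= mulrnBl. Qed.
HB.instance Definition _ i :=
  GRing.isZmodMorphism.Build _ _ (@mfps_deriv K n i) (mfps_derivB i).

Lemma mfps_deriv_agree i d p (P : {mpoly K[n]}) :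
  mfps_agree d.+1 p P -> mfps_agree d (mfps_deriv i p) (mderiv i P).
Proof.
by move=> pP m md /=; rewrite mcoeff_deriv pP // mdegD mdeg1 addn1.
Qed.

Lemma mfps_derivM i p q :
  mfps_deriv i (p * q) = mfps_deriv i p * q + p * mfps_deriv i q.
Proof.
apply/mfpsP => m; have T := @mfps_truncP K n (mdeg m).+1.
have T' r := mfps_agreeW (leqnSn _) (T r).
rewrite (mfps_deriv_agree i (mfps_agreeM (T p) (T q)) (leqnn _)) mderivM mcoeffD.
rewrite -(mfps_agreeM (mfps_deriv_agree i (T p)) (T' q) (leqnn _)).
by rewrite -(mfps_agreeM (T' p) (mfps_deriv_agree i (T q)) (leqnn _)).
Qed.

Lemma mfps_derivC i (c : K) : mfps_deriv i c%:A = 0.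
Proof.
apply/mfpsP => m /=; case: eqP => [/mnmP/(_ i)|]; last by rewrite mulr0 mul0rn.
by rewrite mnmDE mnm1E eqxx mnm0E addn1.
Qed.

Lemma mfps_deriv_var i j : mfps_deriv i ('x_j : {mfps K[n]}) = (i == j)%:R.
Proof.
apply/mfpsP => m /=; have [->|nij] := eqVneq i j.
  rewrite -{2}[U_(j)%MM]add0m eqm_add2r /=.
  by case: eqP => [->|_]; rewrite ?mnm0E ?mul0rn.
case: eqP => [/mnmP/(_ i)|]; last by rewrite mul0rn.
by rewrite mnmDE !mnm1E eqxx eq_sym (negbTE nij) addn1.
Qed.

Lemma ord_ge_deriv d i p : ord_ge d.+1 p -> ord_ge d (mfps_deriv i p).
Proof. by move=> [pd]; split=> m md /=; rewrite pd ?mul0rn // mdegD mdeg1 addn1. Qed.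

(** The difference of the two sides is a derivation along [phi] that kills the
    constants and the variables. *)
Lemma chain_rule phi j p : local_endo phi ->
  mfps_deriv j (phi p) = \sum_i mfps_deriv j (phi 'x_i) * phi (mfps_deriv i p).
Proof.
move=> phi1; apply/eqP; rewrite -subr_eq0; apply/eqP/ord_ge_eq0 => e.
move: p; apply: (@krull_ind _ _ (fun p => _ (phi p) - \sum_i _ * phi (mfps_deriv i p))).
- move=> a b; rewrite !raddfB /=; under eq_bigr do rewrite !raddfB mulrBr.
  by rewrite sumrB; ring.
- move=> c; rewrite endo_alg mfps_derivC big1 ?subrr // => i _.
  by rewrite mfps_derivC endo0 mulr0.
move=> d de IH l p.
under eq_bigr => i _ do rewrite mfps_derivM mfps_deriv_var endoD !endoM endo_nat mulrDr.
rewrite big_split /= (bigD1 l) // eqxx.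
rewrite mul1r big1; last first.
  by move=> i /negbTE->; rewrite mul0r mulr0.
rewrite endoM mfps_derivM.
under [X in _ - (_ + X)]eq_bigr do rewrite mulrCA.
rewrite /= addr0 -mulr_sumr opprD addrACA subrr add0r -mulrBr -add1n.
exact: ord_geM.
Qed.

Lemma near_id_local theta e : (forall i, ord_ge e.+1 (theta 'x_i - 'x_i)) ->
  local_endo theta.
Proof.
move=> th i; rewrite -[theta _](subrK 'x_i); apply: ord_geD; last exact: ord_ge_var.
exact: ord_geW (th i).
Qed.

(** Replacing one factor ['x_i] of a monomial by its image changes the monomial
    by a series whose order is higher by [e]. *)
Lemma near_id_ge theta e s p : (forall i, ord_ge e.+1 (theta 'x_i - 'x_i)) ->
  ord_ge s p -> ord_ge (e + s) (theta p - p).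
Proof.
move=> th; elim: s p => [|s IH] p.
  move=> _; rewrite addn0; apply: (@endo_congr theta idfun).
  - exact: near_id_local th.
  - exact: ord_ge_var.
  - by move=> i; apply: ord_geW (th i).
move=> /ord_geP [q qs ->]; rewrite endo_sum -sumrB; apply: ord_ge_sum => i.
rewrite endoM -(subrKA ('x_i * theta (q i))) -mulrBl -mulrBr; apply: ord_geD.
  rewrite addnS -addSn; apply: ord_geM => //.
  exact/local_endo_ge/qs/(near_id_local th).
by rewrite addnS -add1n; apply: ord_geM; [exact: ord_ge_var|exact: IH].
Qed.

Lemma near_id_bij theta :
  (forall i, ord_ge 2 (theta 'x_i - 'x_i)) -> bijective theta.
Proof.
move=> th; apply: unitri_bij => [p q|d p pd]; first exact: endoB.
by rewrite -add1n; apply: near_id_ge.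
Qed.

Definition directional (b : 'I_n -> {mfps K[n]}) p := \sum_i b i * mfps_deriv i p.

Lemma directionalB b : zmod_morphism (directional b).
Proof.
move=> p q; rewrite /directional -sumrB; apply: eq_bigr => i _.
by rewrite raddfB mulrBr.
Qed.

Lemma directional_sum b (I : finType) (F : I -> {mfps K[n]}) :
  directional b (\sum_k F k) = \sum_k directional b (F k).
Proof.
rewrite /directional exchange_big; apply: eq_bigr => i _.
by rewrite raddf_sum mulr_sumr.
Qed.

Lemma directionalC b (c : K) : directional b c%:A = 0.
Proof. by rewrite /directional big1 // => i _; rewrite mfps_derivC mulr0. Qed.

Lemma directional_var b i p :
  directional b ('x_i * p) = b i * p + 'x_i * directional b p.
Proof.
rewrite /directional.
under eq_bigr => j _ do rewrite mfps_derivM mfps_deriv_var mulrDr.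
rewrite big_split /= (bigD1 i) //= eqxx mul1r big1; last first.
  by move=> j /negbTE->; rewrite mul0r mulr0.
rewrite /= addr0; congr (_ + _); rewrite mulr_sumr; apply: eq_bigr => j _.
by rewrite mulrCA.
Qed.

(** Second-order Taylor formula without denominators, valid in every
    characteristic: the remainder consists of terms in which at least two factors
    ['x_i] have been replaced by [b i], each replacement raising the order by
    [e]. *)
Lemma taylor2 theta b e s p :
  (forall i, theta 'x_i = 'x_i + b i) -> (forall i, ord_ge e.+1 (b i)) ->
  ord_ge s p -> ord_ge (e + e + s) (theta p - p - directional b p).
Proof.
move=> thb be; have th i : ord_ge e.+1 (theta 'x_i - 'x_i) by rewrite thb addrC addKr.
have E i q : theta ('x_i * q) - 'x_i * q - directional b ('x_i * q) =
    'x_i * (theta q - q - directional b q) + b i * (theta q - q).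
  by rewrite endoM thb directional_var; ring.
elim: s p => [|s IH] p.
  move=> _; apply: (@krull_ind _ _ (fun p => theta p - p - directional b p)).
  - by move=> u v; rewrite endoB directionalB; ring.
  - by move=> c; rewrite endo_alg directionalC subrr subr0.
  move=> d de IH i q; rewrite E; apply: ord_geD.
    by rewrite -add1n; apply: ord_geM => //; apply: ord_ge_var.
  apply: (@ord_geW _ _ (e.+1 + (e + 0))); first by rewrite addnA addSn addSn leqW.
  by apply: ord_geM => //; apply: near_id_ge => //; apply: ord_ge0.
move=> /ord_geP [q qs ->]; rewrite endo_sum directional_sum -!sumrB.
apply: ord_ge_sum => i; rewrite E addnS; apply: ord_geD.
  by rewrite -add1n; apply: ord_geM; [exact: ord_ge_var|exact: IH].
by rewrite -addnA -addSn; apply: ord_geM => //; apply: near_id_ge.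
Qed.
End Endomorphisms.

(** * Tjurina ideals under automorphisms and units *)

Section IdealMembership.
Variable A : comNzRingType.
Implicit Types (I J : ideal A) (S : set A) (x y : A).

Lemma ideal_mem0 I : ideal_set I 0. Proof. by case: (idealP I). Qed.
Lemma ideal_memD I x y : ideal_set I x -> ideal_set I y -> ideal_set I (x + y).
Proof. by case: (idealP I) => _ ID _; apply: ID. Qed.
Lemma ideal_memM I x y : ideal_set I y -> ideal_set I (x * y).
Proof. by case: (idealP I) => _ _; apply. Qed.
Lemma ideal_mem_sum I (T : finType) (F : T -> A) :
  (forall k, ideal_set I (F k)) -> ideal_set I (\sum_k F k).
Proof.
move=> IF; elim/big_ind: _ => // [|x y]; [exact: ideal_mem0|exact: ideal_memD].
Qed.

Lemma ideal_gen_mem S x : S x -> ideal_set (ideal_gen S) x.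
Proof. by move=> Sx J [_]; apply. Qed.

Lemma ideal_gen_sub S (J : set A) :
  is_ideal J -> (forall x, S x -> J x) -> forall x, ideal_set (ideal_gen S) x -> J x.
Proof. by move=> iJ SJ x /(_ J); apply. Qed.

Lemma ideal_mul_mem I J x y :
  ideal_set I x -> ideal_set J y -> ideal_set (ideal_mul I J) (x * y).
Proof. by move=> Ix Jy; apply: ideal_gen_mem; exists x => //; exists y. Qed.

Lemma ideal_mul_sub I J (L : set A) : is_ideal L ->
  (forall x y, ideal_set I x -> ideal_set J y -> L (x * y)) ->
  forall z, ideal_set (ideal_mul I J) z -> L z.
Proof.
by move=> iL IJ; apply: ideal_gen_sub => // _ [x Ix [y Jy <-]]; apply: IJ.
Qed.
End IdealMembership.

Section QuotientIsomorphism.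
Variables (K : comNzRingType) (A B : comAlgType K) (I : ideal A) (J : ideal B).

Lemma idquot_isom_of (phi : {lrmorphism A -> B}) : bijective phi ->
  (forall x, ideal_set I x <-> ideal_set J (phi x)) -> idquot_isom I J.
Proof.
case=> g phiK gK IJ.
pose F (q : idquot I) : idquot J := idquot_pi J (phi (idquot_repr q)).
have Fpi x : F (idquot_pi I x) = idquot_pi J (phi x).
  apply/idquot_eqP; rewrite -rmorphB; apply/IJ/idquot_eqP; exact: idquot_reprK.
have E q : exists x, q = idquot_pi I x by exists (idquot_repr q); rewrite idquot_reprK.
have FB : zmod_morphism F.
  by move=> p q; have [[x ->] [y ->]] := (E p, E q); rewrite -raddfB !Fpi !raddfB.
have FM : monoid_morphism F.
  split; first by rewrite -[1]/(idquot_pi I 1) Fpi rmorph1.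
  by move=> p q; have [[x ->] [y ->]] := (E p, E q); rewrite -rmorphM !Fpi !rmorphM.
have FZ : scalable F.
  move=> c q; have [x ->] := E q.
  by rewrite -[c *: _]idquot_piZ !Fpi linearZ /= idquot_piZ.
pose f1 := GRing.isZmodMorphism.Build _ _ F FB.
pose f2 := GRing.isMonoidMorphism.Build _ _ F FM.
pose G : {rmorphism idquot I -> idquot J} := HB.pack F f1 f2.
exists G => //; exists (fun q => idquot_pi I (g (idquot_repr q))) => q /=.
  have [x ->] := E q; rewrite Fpi; apply/idquot_eqP/IJ; rewrite rmorphB /= gK.
  by apply/idquot_eqP; rewrite idquot_reprK.
by rewrite Fpi gK idquot_reprK.
Qed.
End QuotientIsomorphism.

Section TjurinaSpan.
Variables (K : fieldType) (n : nat).
Notation endo := {lrmorphism {mfps K[n]} -> {mfps K[n]}}.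
Implicit Types (f p q h : {mfps K[n]}) (i j : 'I_n) (phi : endo).
Implicit Types (b : 'I_n -> {mfps K[n]}).

(** All ideals of the theorem have this form: [tj_span 0 k f] is the [k]-th
    Tjurina ideal, and [tj_span 1 2 f] is the ideal of the determinacy
    condition.  Bounding the orders of the coefficients [a] and [b] separately
    is what the determinacy argument needs. *)
Definition tj_span (d e : nat) f : set {mfps K[n]} := fun p =>
  exists a b, [/\ ord_ge d a, forall i, ord_ge e (b i) & p = a * f + directional b f].

Lemma directional_scale b c f :
  directional (fun i => c * b i) f = c * directional b f.
Proof. by rewrite mulr_sumr; apply: eq_bigr => i _; rewrite mulrA. Qed.

Lemma directional_add b b' f :
  directional (fun i => b i + b' i) f = directional b f + directional b' f.
Proof. by rewrite -big_split; apply: eq_bigr => i _; rewrite mulrDl. Qed.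

Lemma directional0 f : directional (fun=> 0) f = 0.
Proof. by rewrite /directional big1 // => i _; rewrite mul0r. Qed.

Lemma tj_span_ideal d e f : is_ideal (tj_span d e f).
Proof.
split=> [|_ _ [a [b [ad be ->]]] [a' [b' [ad' be' ->]]]|c _ [a [b [ad be ->]]]].
- exists 0, (fun=> 0); split; try by move=> *; apply: ord_ge_zero.
  by rewrite directional0 mul0r addr0.
- exists (a + a'), (fun i => b i + b' i); split; try by move=> *; apply: ord_geD.
  by rewrite directional_add mulrDl addrACA.
- exists (c * a), (fun i => c * b i); split; try by move=> *; apply: ord_geMl.
  by rewrite directional_scale mulrDr mulrA.
Qed.

Lemma tj_span_self d e f a : ord_ge d a -> tj_span d e f (a * f).
Proof.
move=> ad; exists a, (fun=> 0); split=> //.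
by rewrite directional0 addr0.
Qed.

Lemma tj_span_directional d e f b :
  (forall i, ord_ge e (b i)) -> tj_span d e f (directional b f).
Proof.
by move=> be; exists 0, b; split; rewrite ?mul0r ?add0r //; apply: ord_ge_zero.
Qed.

Lemma partial_mem f i : partials f (mfps_deriv i f).
Proof. by exists i. Qed.

Lemma jacobianP f p :
  ideal_set (jacobian_ideal f) p -> exists b, p = directional b f.
Proof.
apply: (@ideal_gen_sub _ _ [set p | exists b, p = directional b f]).
  split=> [|_ _ [b ->] [b' ->]|c _ [b ->]] /=.
  - by exists (fun=> 0); rewrite directional0.
  - by exists (fun i => b i + b' i); rewrite directional_add.
  - by exists (fun i => c * b i); rewrite directional_scale.
move=> _ [i _ <-] /=; exists (fun j => (j == i)%:R); rewrite /directional.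
rewrite (bigD1 i) // eqxx mul1r big1 /= ?addr0 // => j /negbTE->.
by rewrite mul0r.
Qed.

Lemma mpow_jacobian_mem e f b : (forall i, ord_ge e (b i)) ->
  ideal_set (ideal_mul (ideal_exp (max_ideal K n) e) (jacobian_ideal f))
    (directional b f).
Proof.
move=> be; apply: ideal_mem_sum => i; apply: ideal_mul_mem; first exact/ideal_expE.
by apply: ideal_gen_mem; exact: partial_mem.
Qed.

Lemma mpow_jacobian_span d e f p :
  ideal_set (ideal_mul (ideal_exp (max_ideal K n) e) (jacobian_ideal f)) p ->
  tj_span d e f p.
Proof.
apply: ideal_mul_sub; first exact: tj_span_ideal.
move=> x _ /ideal_expE xe /jacobianP [b ->]; rewrite -directional_scale.
by apply: tj_span_directional => i; apply: ord_geMr.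
Qed.

Lemma higher_tjurinaE k f p :
  ideal_set (higher_tjurina_ideal k f) p <-> tj_span 0 k f p.
Proof.
split=> [|[a [b [_ bk ->]]]].
  apply: ideal_gen_sub; first exact: tj_span_ideal.
  move=> x [->|]; last exact: mpow_jacobian_span.
  by rewrite -[f]mul1r -{2}[f]mul1r; apply: tj_span_self; apply: ord_ge0.
apply: ideal_memD; first by apply: ideal_memM; apply: ideal_gen_mem; apply: or_introl.
by apply: ideal_gen_mem; apply: or_intror; apply: mpow_jacobian_mem.
Qed.

Lemma tjurinaE f p : ideal_set (tjurina_ideal f) p <-> tj_span 0 0 f p.
Proof.
split=> [|[a [b [_ _ ->]]]].
  apply: ideal_gen_sub; first exact: tj_span_ideal.
  move=> x [->|/ideal_gen_mem /jacobianP [b ->]].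
    by rewrite -[f]mul1r -{2}[f]mul1r; apply: tj_span_self; apply: ord_ge0.
  by apply: tj_span_directional => i; apply: ord_ge0.
apply: ideal_memD; first by apply: ideal_memM; apply: ideal_gen_mem; apply: or_introl.
apply: ideal_mem_sum => i; apply: ideal_memM; apply: ideal_gen_mem.
by apply: or_intror; apply: partial_mem.
Qed.

Lemma determinacy_boundE f s k : determinacy_bound f s k <->
  forall p, ord_ge ((k + 2 * s) %/ 2) p -> tj_span 1 2 f p.
Proof.
rewrite /determinacy_bound; set L := (_ %/ _)%N; split=> H p pL.
  have [x xm [y ym <-]] := H p (iffRL (ideal_expE _ _) pL).
  case: (tj_span_ideal 1 2 f) => _ spanD _; apply: spanD.
    move: (xm); apply: (ideal_mul_sub (tj_span_ideal 1 2 f)).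
    move=> u v /max_idealE u1 vf; move: v vf.
    apply: (@ideal_gen_sub _ _ [set v | tj_span 1 2 f (u * v)]).
      case: (tj_span_ideal 1 2 f) => span0 spanD' spanM.
      split=> [|a b|c a] /=; rewrite ?mulr0 ?mulrDr 1?mulrCA //.
      - exact: spanD'.
      - exact: spanM.
    by move=> _ ->; apply: tj_span_self.
  exact: mpow_jacobian_span ym.
have [a [b [a1 b2 ->]]] := H p (iffLR (ideal_expE _ _) pL).
exists (a * f); first by apply: ideal_mul_mem; [exact/max_idealE|by apply: ideal_gen_mem].
by exists (directional b f) => //; apply: mpow_jacobian_mem.
Qed.

(** By the chain rule for the inverse automorphism, the images of the partial
    derivatives of [f] are combinations of the partial derivatives of
    [phi f]. *)
Lemma tj_span_auto d e f p phi : bijective phi ->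
  tj_span d e f p -> tj_span d e (phi f) (phi p).
Proof.
move=> phib [a [b [ad be ->]]]; have phi1 := bij_local_endo phib.
have [psi [psib phiK psiK]] := endo_inverse phib.
exists (phi a), (fun j => \sum_i phi (b i) * phi (mfps_deriv i (psi 'x_j))); split.
- exact: local_endo_ge.
- by move=> j; apply: ord_ge_sum => i; apply/ord_geMr/local_endo_ge.
rewrite endoD endoM endo_sum; congr (_ + _); rewrite /directional.
under [RHS]eq_bigr do rewrite mulr_suml.
rewrite exchange_big; apply: eq_bigr => i _.
rewrite endoM -{1}[f]phiK (chain_rule _ _ (bij_local_endo psib)) endo_sum mulr_sumr.
by apply: eq_bigr => j _; rewrite endoM psiK mulrA.
Qed.

Lemma tj_span_mulr e u f p : tj_span 0 e (u * f) p -> tj_span 0 e f p.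
Proof.
move=> [a [b [_ be ->]]].
exists (a * u + directional b u), (fun i => u * b i); split.
- exact: ord_ge0.
- by move=> i; apply: ord_geMl.
rewrite directional_scale mulrDl -!addrA mulrA; congr (_ + _).
rewrite /directional mulr_suml mulr_sumr -big_split; apply: eq_bigr => i _ /=.
by rewrite mfps_derivM; ring.
Qed.

Lemma tj_span_unit e u f p : u \is a GRing.unit ->
  tj_span 0 e (u * f) p <-> tj_span 0 e f p.
Proof.
move=> uU; split; first exact: tj_span_mulr.
by rewrite -{1}[f](mulKr uU); apply: tj_span_mulr.
Qed.

Lemma contact_higher_tjurina k f g :
  contact_equivalent f g -> higher_tjurina_isom k f g.
Proof.
move=> [phi [u [phib uU ->]]]; apply: (idquot_isom_of phib) => p.
rewrite !higher_tjurinaE tj_span_unit //; split; first exact: tj_span_auto.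
have [psi [psib phiK psiK]] := endo_inverse phib.
by move/(tj_span_auto psib); rewrite !phiK.
Qed.
End TjurinaSpan.

(** * Finite Tjurina number *)

(** The coordinates form a matrix with more rows than columns. *)
Lemma linear_dependence (K : fieldType) (V : lmodType K) d (v : 'I_d.+1 -> V) :
  has_dim V d -> exists2 w : 'rV[K]_d.+1, w != 0 & \sum_j w 0 j *: v j = 0.
Proof.
move=> [e e_basis].
have /boolp.choice [c cE] : forall j, exists c : 'rV[K]_d, v j = \sum_i c 0 i *: e i.
  by move=> j; have [c [cE _]] := e_basis (v j); exists c.
pose C := \matrix_(j < d.+1) c j.
have : kermx C != 0 by rewrite -mxrank_eq0 mxrank_ker subn_eq0 -ltnNge ltnS rank_leq_col.
case/rowV0Pn => w /sub_kermxP wC w0; exists w => //.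
under eq_bigr do rewrite cE scaler_sumr.
rewrite exchange_big big1 //= => i _.
under eq_bigr do rewrite scalerA.
rewrite -scaler_suml; have <- : (w *m C) 0 i = \sum_j w 0 j * c j 0 i.
  by rewrite mxE; apply: eq_bigr => j _; rewrite mxE.
by rewrite wC mxE scale0r.
Qed.

Section FiniteTjurina.
Variables (K : fieldType) (n : nat).
Implicit Types (f p q h : {mfps K[n]}) (i : 'I_n) (I : ideal {mfps K[n]}).

Lemma mfcoef0M p q : mfcoef (p * q) 0%MM = mfcoef p 0%MM * mfcoef q 0%MM.
Proof.
rewrite {1}(var_quotP p) mulrDl mulr_algl.
have : ord_ge 1 ((\sum_i 'x_i * var_quot p i) * q).
  by apply: ord_geMr; apply: ord_ge_sum => i; apply/ord_geMr/ord_ge_var.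
move/ord_ge_coef => H.
by rewrite [LHS]/= -[X in _ + X]/(mfcoef (_ * q) 0%MM) H ?mdeg0 // addr0.
Qed.

(** The powers of [p] up to the [d]-th are dependent modulo [I]; since [p] has
    positive order, the relation is its lowest power times a unit. *)
Lemma power_mem_of_dim I d p : ord_ge 1 p -> has_dim (idquot I) d ->
  ideal_set I (p ^+ d).
Proof.
move=> p1 /(linear_dependence (fun j : 'I_d.+1 => idquot_pi I (p ^+ j))) [w w0].
under eq_bigr do rewrite -linearZ.
rewrite -raddf_sum => /=; rewrite -(raddf0 (idquot_pi I)) => /idquot_eqP.
rewrite subr0 => wI.
(* the lowest power of p with nonzero coefficient *)
have [a wa amin] : exists2 a : 'I_d.+1, w 0 a != 0 &
    forall j : 'I_d.+1, (j < a)%N -> w 0 j = 0.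
  have /existsP [a0 wa0] : [exists a, w 0 a != 0].
    apply: contraNT w0 => /existsPn w0; apply/eqP/rowP => j; rewrite mxE.
    by apply/eqP/negPn.
  have [a wa amin] := @arg_minnP _ a0 (fun j => w 0 j != 0) (@nat_of_ord _) wa0.
  exists a => // j ja; apply/eqP/negPn/negP => /amin; by rewrite leqNgt ja.
pose r := \sum_(j : 'I_d.+1) (if (j < a)%N then 0 else w 0 j *: p ^+ (j - a)).
have rI : ideal_set I (p ^+ a * r).
  move: wI; congr (ideal_set I _); rewrite mulr_sumr; apply: eq_bigr => j _.
  have [/amin->|aj] := ltnP; first by rewrite scale0r mulr0.
  by rewrite -scalerAr -exprD subnKC.
have /unitrP [r' [r'r _]] : r \is a GRing.unit.
  apply: unit_of_coef0; rewrite mfcoef_sum (bigD1 a) //= ltnn subnn expr0 /= eqxx mulr1.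
  rewrite big1 ?addr0 // => j ja; case: ltnP => // aj.
  have jap : (0 < j - a)%N by rewrite subn_gt0 ltn_neqAle eq_sym ja.
  rewrite -[(j - a)%N]prednK // exprS.
  have /ord_ge_coef jp : ord_ge 1 (w 0 j *: (p * p ^+ (j - a).-1)).
    by apply/ord_geZ/ord_geMr.
  by rewrite jp ?mdeg0.
have -> : p ^+ d = (p ^+ (d - a) * r') * (p ^+ a * r).
  by rewrite mulrACA r'r mulr1 -exprD subnK // -ltnS.
exact: ideal_memM.
Qed.

(** A monomial of degree greater than [n * d] contains some variable to the
    power [d]. *)
Lemma mpow_mem_of_var_powers I d : (forall i, ideal_set I ('x_i ^+ d)) ->
  forall p, ord_ge (n * d).+1 p -> ideal_set I p.
Proof.
move=> xI p pN; pose X (m : 'X_{1..n}) := \prod_i ('x_i : {mfps K[n]}) ^+ m i.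
suff H e (m : 'X_{1..n}) h :
    (mdeg m + e = (n * d).+1)%N -> ord_ge e h -> ideal_set I (X m * h).
  have := H (n * d).+1 0%MM p; rewrite mdeg0 /X big1 ?mul1r; first exact.
  by move=> i _; rewrite mnm0E expr0.
elim: e m h => [|e IH] m h mN he.
  have /existsP [i di] : [exists i, (d <= m i)%N].
    apply: contraPT mN => /existsPn md; rewrite addn0 => mE.
    have : (mdeg m <= n * d)%N.
      rewrite mdegE -[n in (n * d)%N]card_ord -sum_nat_const; apply: leq_sum => i _.
      by apply: ltnW; rewrite ltnNge.
    by rewrite mE ltnn.
  rewrite mulrC; apply: ideal_memM; rewrite /X (bigD1 i) //= mulrC.
  by apply: ideal_memM; rewrite -(subnK di) exprD; apply: ideal_memM.
have /ord_geP [q qe ->] := he.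
rewrite mulr_sumr; apply: ideal_mem_sum => i; rewrite mulrA.
have -> : X m * 'x_i = X (m + U_(i))%MM.
  rewrite /X [RHS](bigD1 i) //= [in LHS](bigD1 i) //= mnmDE mnm1E eqxx addn1 exprSr.
  rewrite mulrAC; congr (_ * _); apply: eq_bigr => j ji.
  by rewrite mnmDE mnm1E eq_sym (negbTE ji) addn0.
by apply: IH => //; rewrite mdegD mdeg1 addn1 addSnnS.
Qed.

Lemma tjurina_finite_mpow f : tjurina_finite f ->
  exists N, forall p, ord_ge N p -> tj_span 0 0 f p.
Proof.
move=> [d fd]; exists (n * d).+1 => p pN; apply/tjurinaE.
apply: mpow_mem_of_var_powers pN => i.
by apply: power_mem_of_dim fd; apply: ord_ge_var.
Qed.

Lemma tj_span_varM d e f p i : tj_span d e f p -> tj_span d.+1 e.+1 f ('x_i * p).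
Proof.
move=> [a [b [ad be ->]]]; exists ('x_i * a), (fun j => 'x_i * b j); split.
- by rewrite -add1n; apply: ord_geM => //; apply: ord_ge_var.
- by move=> j; rewrite -add1n; apply: ord_geM => //; apply: ord_ge_var.
- by rewrite directional_scale mulrDr mulrA.
Qed.

(** The inclusion can be multiplied by powers of the maximal ideal, which
    improves the coefficients of [f] and of its derivatives. *)
Lemma tj_span_mpow f N d e : (forall p, ord_ge N p -> tj_span d e f p) ->
  forall t p, ord_ge (N + t) p -> tj_span (d + t) (e + t) f p.
Proof.
move=> NS; elim=> [|t IH] p; rewrite ?addnS ?addn0; first exact: NS.
move=> /ord_geP [q qN ->]; case: (tj_span_ideal (d + t).+1 (e + t).+1 f) => S0 SD _.
by elim/big_ind: _ => // i _; apply/tj_span_varM/IH.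
Qed.

Lemma determinacy_bound_exists f s :
  tjurina_finite f -> exists k, determinacy_bound f s k.
Proof.
move=> /tjurina_finite_mpow [N NS]; exists (2 * (N + 2))%N.
apply/determinacy_boundE; rewrite -mulnDr mulKn // => p pN.
have [a [b [a2 b2 ->]]] := tj_span_mpow NS (ord_geW (leq_addr s _) pN).
by exists a, b; split=> //; apply: ord_geW a2.
Qed.
End FiniteTjurina.

(** * Lifting isomorphisms of quotients to automorphisms *)

Section LinearPart.
Variables (K : fieldType) (n : nat).
Notation endo := {lrmorphism {mfps K[n]} -> {mfps K[n]}}.
Implicit Types (p q : {mfps K[n]}) (phi psi theta : endo).

(** The matrix of the map induced by [phi] on the cotangent space. *)
Definition jacobian_at0 phi : 'M[K]_n :=
  \matrix_(i, j) mfcoef (mfps_deriv j (phi 'x_i)) 0%MM.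

Lemma deriv_at0 i p : mfcoef (mfps_deriv i p) 0%MM = mfcoef p U_(i)%MM.
Proof. by rewrite /= add0m mnm0E. Qed.

Lemma endo_coef0 phi p : local_endo phi -> mfcoef (phi p) 0%MM = mfcoef p 0%MM.
Proof.
move=> phi1; rewrite {1}(var_quotP p) endoD endo_alg endo_sum.
have : ord_ge 1 (\sum_i phi ('x_i * var_quot p i)).
  by apply: ord_ge_sum => i; rewrite endoM; apply/ord_geMr/phi1.
by move=> /ord_ge_coef H /=; rewrite H ?mdeg0 // eqxx mulr1 addr0.
Qed.

Lemma jacobian_at0_comp phi psi (theta := psi \o phi : endo) :
  local_endo phi -> local_endo psi ->
  jacobian_at0 theta = jacobian_at0 phi *m jacobian_at0 psi.
Proof.
move=> phi1 psi1; apply/matrixP => i j; rewrite !mxE.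
rewrite [theta _]/(psi (phi 'x_i)) (chain_rule _ _ psi1) mfcoef_sum.
apply: eq_bigr => k _; rewrite mfcoef0M endo_coef0 // mulrC.
by rewrite !mxE.
Qed.

Lemma mfcoef0_bool (b : bool) : mfcoef (b%:R : {mfps K[n]}) 0%MM = b%:R.
Proof. by case: b; rewrite // !mulr1n /= eqxx. Qed.

Lemma near_id_jacobian theta : local_endo theta ->
  (jacobian_at0 theta = 1%:M <-> forall i, ord_ge 2 (theta 'x_i - 'x_i)).
Proof.
move=> th1; split=> [J i|th].
  split=> m; case: (posnP (mdeg m)) => [m0 _|m_gt0 m_lt2].
    have /ord_ge_coef -> // : ord_ge 1 (theta 'x_i - 'x_i); last by rewrite m0.
    by apply: ord_geB; [exact: th1|exact: ord_ge_var].
  have /mdeg1P [j /eqP ->] : mdeg m == 1%N by rewrite eqn_leq -ltnS m_lt2.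
  move/matrixP/(_ i j): J; rewrite !mxE deriv_at0 mfcoefB => ->.
  by rewrite -deriv_at0 mfps_deriv_var mfcoef0_bool eq_sym subrr.
apply/matrixP => i j; rewrite !mxE deriv_at0.
move/ord_ge_coef/(_ U_(j)%MM): (th i); rewrite mdeg1 => /(_ isT)/eqP.
rewrite mfcoefB subr_eq0 => /eqP ->; rewrite -deriv_at0 mfps_deriv_var.
by rewrite mfcoef0_bool eq_sym.
Qed.

(** A one-sided inverse modulo order 2 is two-sided on the cotangent space, as
    square matrices with product 1 commute.  So both composites are tangent to
    the identity, hence bijective. *)
Lemma near_inverse_bij phi psi : local_endo phi -> local_endo psi ->
  (forall i, ord_ge 2 (psi (phi 'x_i) - 'x_i)) -> bijective phi.
Proof.
move=> phi1 psi1 psiphi.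
have comp_local (a b : endo) : local_endo a -> local_endo b -> local_endo (a \o b : endo).
  by move=> a1 b1 i; apply: (local_endo_ge a1); exact: b1.
have J1 : jacobian_at0 phi *m jacobian_at0 psi = 1%:M.
  by rewrite -jacobian_at0_comp //; apply/near_id_jacobian => //; apply: comp_local.
have [g gK Kg] : bijective (phi \o psi : endo).
  apply: near_id_bij; apply/near_id_jacobian; first exact: comp_local.
  by rewrite jacobian_at0_comp // mulmx1C.
have [g' g'K _] : bijective (psi \o phi : endo) by apply: near_id_bij.
have phi_inj : injective phi.
  by move=> p q pq; rewrite -[p]g'K -[q]g'K /= pq.
have gP p : phi (psi (g p)) = p := Kg p.
by exists (psi \o g) => p; [apply: phi_inj|]; rewrite /= gP.
Qed.
End LinearPart.

Section Lifting.
Variables (K : fieldType) (n : nat).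
Notation endo := {lrmorphism {mfps K[n]} -> {mfps K[n]}}.
Implicit Types (p q : {mfps K[n]}) (phi psi theta : endo) (I J : ideal {mfps K[n]}).

(** A morphism into a quotient by an ideal containing a power of the maximal
    ideal is automatically continuous, so the images of the variables determine
    it. *)
Lemma quotient_morphism_lift J N (alpha : {rmorphism {mfps K[n]} -> idquot J}) phi :
  (forall p, ord_ge N p -> ideal_set J p) -> scalable alpha -> local_endo phi ->
  (forall i, alpha 'x_i = idquot_pi J (phi 'x_i)) ->
  forall p, alpha p = idquot_pi J (phi p).
Proof.
move=> NJ alphaZ phi1 alpha_x p.
suff [q /NJ Jq ->] : exists2 q, ord_ge N q & alpha p = idquot_pi J (phi p + q).
  by apply/idquot_eqP; rewrite addrC addKr.
elim: N {NJ} p => [|N IH] p.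
  exists (idquot_repr (alpha p) - phi p); first exact: ord_ge0.
  by rewrite addrC subrK idquot_reprK.
have /boolp.choice [q qP] : forall i, exists q, ord_ge N q /\
    alpha (var_quot p i) = idquot_pi J (phi (var_quot p i) + q).
  by move=> i; have [q qN qE] := IH (var_quot p i); exists q.
exists (\sum_i phi 'x_i * q i).
  apply: ord_ge_sum => i; rewrite -add1n; apply: ord_geM; first exact: phi1.
  by case: (qP i).
have alpha_const (c : K) : alpha c%:A = idquot_pi J c%:A.
  by rewrite alphaZ rmorph1 linearZ /= rmorph1.
rewrite {1 2}(var_quotP p) rmorphD alpha_const endoD endo_alg -addrA raddfD.
congr (_ + _); rewrite endo_sum -big_split /= !raddf_sum; apply: eq_bigr => i _.
have [_ E] := qP i.
by rewrite /= endoM -mulrDr !rmorphM alpha_x E.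
Qed.

(** If [q] were a unit, then [p] would be one modulo [I], which is impossible as
    both [p] and [I] lie in the maximal ideal. *)
Lemma quotient_isom_local I J (Phi : {rmorphism idquot I -> idquot J}) p q :
  bijective Phi -> (forall h, ideal_set I h -> ord_ge 1 h) ->
  ord_ge 1 p -> Phi (idquot_pi I p) = idquot_pi J q -> ord_ge 1 q.
Proof.
move=> [Psi PhiK PsiK] I1 p1 Phi_p; apply: nonunit_ord_ge1 => /unitrP [r [rq _]].
set w := idquot_repr (Psi (idquot_pi J r)).
have /idquot_eqP /I1 wp1 : idquot_pi I (w * p) = idquot_pi I 1.
  apply: (can_inj PhiK); rewrite !rmorphM /= Phi_p idquot_reprK PsiK.
  by rewrite -rmorphM rq !rmorph1.
apply: (@ord_ge1_one K n); rewrite -[1](subKr (w * p)).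
by apply: ord_geB => //; apply: ord_geMl.
Qed.

Lemma idquot_inverse I J (Phi : {rmorphism idquot I -> idquot J}) :
  scalable Phi -> bijective Phi ->
  exists Psi : {rmorphism idquot J -> idquot I},
    [/\ scalable Psi, cancel Phi Psi & cancel Psi Phi].
Proof.
move=> PhiZ Phib; have [g gK Kg] := Phib.
have gB : zmod_morphism g.
  by move=> a b; apply: (bij_inj Phib); rewrite rmorphB !Kg.
have gM : monoid_morphism g.
  by split=> [|a b]; apply: (bij_inj Phib); rewrite ?rmorphM ?rmorph1 !Kg.
pose g1 := GRing.isZmodMorphism.Build _ _ g gB.
pose g2 := GRing.isMonoidMorphism.Build _ _ g gM.
pose G : {rmorphism idquot J -> idquot I} := HB.pack g g1 g2.
by exists G; split=> // a b; apply: (bij_inj Phib); rewrite PhiZ !Kg.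
Qed.

(** The images of the variables under the isomorphism and under its inverse are
    lifted to two substitutions.  They are inverse to each other modulo [I], hence
    modulo order 2, which makes them automorphisms. *)
Lemma quotient_isom_lift I J N :
  (forall p, ord_ge N p -> ideal_set I p) -> (forall p, ideal_set I p -> ord_ge 2 p) ->
  idquot_isom I J ->
  exists2 phi : endo, bijective phi & forall p, ideal_set I p <-> ideal_set J (phi p).
Proof.
move=> NI I2 [Phi PhiZ Phib].
have I1 p (Ip : ideal_set I p) := ord_geW (leqnSn 1) (I2 p Ip).
have [Psi [PsiZ PhiK PsiK]] := idquot_inverse PhiZ Phib.
have J1 p : ideal_set J p -> ord_ge 1 p.
  move=> Jp; apply: nonunit_ord_ge1 => /unitrP [r [rp _]].
  have : idquot_pi I 1 = idquot_pi I 0.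
    apply: (can_inj PhiK); rewrite !rmorph1 !rmorph0 -(rmorph0 (idquot_pi J)).
    rewrite -(rmorph1 (idquot_pi J)); apply/idquot_eqP.
    by rewrite subr0 -rp; apply: ideal_memM.
  by move=> /idquot_eqP; rewrite subr0 => /I1 /ord_ge1_one.
have [phi phi_x] : exists phi : endo, forall i,
    phi 'x_i = idquot_repr (Phi (idquot_pi I 'x_i)).
  apply: (@subst_exists _ _ (fun i => idquot_repr (Phi (idquot_pi I 'x_i)))) => i.
  apply: (quotient_isom_local Phib I1 (ord_ge_var i)).
  by rewrite idquot_reprK.
have [psi psi_x] : exists psi : endo, forall i,
    psi 'x_i = idquot_repr (Psi (idquot_pi J 'x_i)).
  have Psib : bijective Psi by exists Phi.
  apply: (@subst_exists _ _ (fun i => idquot_repr (Psi (idquot_pi J 'x_i)))) => i.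
  apply: (quotient_isom_local Psib J1 (ord_ge_var i)).
  by rewrite idquot_reprK.
have phi1 : local_endo phi.
  move=> i; apply: (quotient_isom_local Phib I1 (ord_ge_var i)).
  by rewrite phi_x idquot_reprK.
have psi1 : local_endo psi.
  have Psib : bijective Psi by exists Phi.
  move=> i; apply: (quotient_isom_local Psib J1 (ord_ge_var i)).
  by rewrite psi_x idquot_reprK.
have Psi_pi p : Psi (idquot_pi J p) = idquot_pi I (psi p).
  apply: (@quotient_morphism_lift I N (Psi \o idquot_pi J) psi) => //.
    by move=> c q; rewrite /= linearZ /= PsiZ.
  by move=> i; rewrite /= psi_x idquot_reprK.
have NJ p : ord_ge N p -> ideal_set J p.
  move=> pN; rewrite -[p]subr0; apply/idquot_eqP; apply: (can_inj PsiK).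
  rewrite Psi_pi !rmorph0 -(rmorph0 (idquot_pi I)); apply/idquot_eqP.
  by rewrite subr0; apply/NI/local_endo_ge.
have Phi_pi p : Phi (idquot_pi I p) = idquot_pi J (phi p).
  apply: (@quotient_morphism_lift J N (Phi \o idquot_pi I) phi) => //.
    by move=> c q; rewrite /= linearZ /= PhiZ.
  by move=> i; rewrite /= phi_x idquot_reprK.
exists phi.
  apply: (@near_inverse_bij _ _ phi psi) => // i; apply: I2; apply/idquot_eqP.
  by rewrite -Psi_pi -Phi_pi PhiK.
move=> p; split=> [Ip|Jp].
  rewrite -[phi p]subr0; apply/idquot_eqP; rewrite -Phi_pi rmorph0.
  rewrite -(rmorph0 Phi) -(rmorph0 (idquot_pi I)).
  by congr (Phi _); apply/idquot_eqP; rewrite subr0.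
rewrite -[p]subr0; apply/idquot_eqP; apply: (can_inj PhiK).
rewrite Phi_pi !rmorph0 -(rmorph0 (idquot_pi J)); apply/idquot_eqP.
by rewrite subr0.
Qed.
End Lifting.

(** * Finite determinacy *)

Section Determinacy.
Variables (K : fieldType) (n : nat).
Notation endo := {lrmorphism {mfps K[n]} -> {mfps K[n]}}.
Implicit Types (p q f : {mfps K[n]}) (phi psi theta : endo).

Lemma ord_ge_directional e s (b : 'I_n -> {mfps K[n]}) f :
  (forall i, ord_ge e.+1 (b i)) -> ord_ge s f -> ord_ge (e + s) (directional b f).
Proof.
move=> be fs; apply: ord_ge_sum => i; case: s fs => [|s] fs.
  by rewrite addn0; apply/ord_geMr/(ord_geW (leqnSn e)).
by rewrite addnS -addSn; apply: ord_geM => //; apply: ord_ge_deriv.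
Qed.

Section Step.
Variables (f : {mfps K[n]}) (s L : nat).
Hypothesis fs : ord_ge s f.
Hypothesis fL : forall p, ord_ge L p -> tj_span 1 2 f p.

(** Contact equivalence with [f] realises any perturbation [r] of high order up
    to one order more.  Writing [r = a f + sum_i b_i d_i f], the unit [1 + a] and
    the substitution of ['x_i + b i] for ['x_i] produce [f + r] to first order;
    the quadratic terms have order at least [2t + 2 + s], and the hypothesis on
    [t] says that this exceeds [L + t]. *)
Lemma one_step t r : (L <= s + t.+1)%N -> ord_ge (L + t) r ->
  exists theta (v : {mfps K[n]}),
    [/\ forall i, ord_ge t.+2 (theta 'x_i - 'x_i), ord_ge t.+1 (v - 1)
      & ord_ge (L + t).+1 (v * theta f - (f + r))].
Proof.
move=> Lst /(tj_span_mpow fL) [a [b [at1 bt2 ->]]].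
have [theta thb] : exists theta : endo, forall i, theta 'x_i = 'x_i + b i.
  apply: (@subst_exists _ _ (fun i => 'x_i + b i)) => i.
  by apply: ord_geD; [exact: ord_ge_var|apply: ord_geW (bt2 i)].
exists theta, (1 + a); split=> [i||]; first by rewrite thb addrC addKr; apply: bt2.
  by rewrite addrC addKr.
have -> : (1 + a) * theta f - (f + (a * f + directional b f)) =
  a * directional b f + (1 + a) * (theta f - f - directional b f) by ring.
apply: (@ord_geW _ _ (t.+1 + (t.+1 + s))).
  by rewrite -addnS addnC leq_add2l addnC.
apply: ord_geD; first by apply: ord_geM => //; apply: ord_ge_directional.
by rewrite addnA; apply: ord_geMl; apply: taylor2 thb _ fs.
Qed.

Variables (t0 : nat) (F : {mfps K[n]}).
Hypothesis Lst0 : (L <= s + t0.+1)%N.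

(** A state is a pair of an automorphism and a unit that carry [f] to the target
    [F] up to the order indicated. *)
Definition approx d (st : endo * {mfps K[n]}) :=
  [/\ forall i, ord_ge 2 (st.1 'x_i - 'x_i), ord_ge 1 (st.2 - 1)
    & ord_ge (L + (t0 + d)) (st.2 * st.1 f - F)].

(** The correction is always computed for [f] itself and not for its current
    transform.  This suffices because the current automorphism and unit are the
    identity to first order, so they do not alter the leading part of the error
    [r], and no inclusion like [fL] has to be established for the transforms. *)
Lemma approx_improve d st : exists st' : endo * {mfps K[n]}, approx d st ->
  [/\ approx d.+1 st', forall i, ord_ge d (st'.1 'x_i - st.1 'x_i)
    & ord_ge d (st'.2 - st.2)].
Proof.
have [app|napp] := pselect (approx d st); last by exists st => /napp.
case: st app => phi u [phi2 u1 fN]; rewrite /= in phi2 u1 fN.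
have phi1 : local_endo phi by apply: near_id_local phi2.
have [||theta [v [th vt fN1]]] := @one_step (t0 + d) (F - u * phi f).
- by apply: leq_trans Lst0 _; rewrite leq_add2l ltnS leq_addr.
- by rewrite -opprB; apply: ord_geN.
set r := F - _ in fN1; set w := _ - (f + r) in fN1.
have phi_th i : ord_ge (t0 + d).+2 (phi (theta 'x_i) - phi 'x_i).
  by rewrite -endoB; apply: local_endo_ge.
have u_v : ord_ge (t0 + d).+1 (u * phi v - u).
  by rewrite -[X in _ - X]mulr1 -mulrBr -(endo1 phi) -endoB; apply/ord_geMl/local_endo_ge.
exists (phi \o theta : endo, u * phi v) => _; split=> [|i|]; last 2 first.
- by apply: ord_geW (phi_th i); rewrite !leqW ?leq_addl.
- by apply: ord_geW u_v; rewrite leqW ?leq_addl.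
split=> [i||] /=.
- rewrite -(subrKA (phi 'x_i)); apply: ord_geD => //.
  exact: ord_geW (phi_th i).
- by rewrite -(subrKA u); apply: ord_geD => //; apply: ord_geW u_v.
(* With w the error of the step and r the old defect, u * phi (f + r) - F is the
   amount by which u and phi change r. *)
have -> : u * phi v * phi (theta f) - F = u * phi w + ((u - 1) * phi r + (phi r - r)).
  by rewrite -mulrA -endoM -[v * _](subrK (f + r)) -/w !endoD /r; ring.
have rN : ord_ge (L + (t0 + d)) r by rewrite /r -opprB; apply: ord_geN.
rewrite !addnS; apply: ord_geD; first exact/ord_geMl/local_endo_ge.
rewrite -add1n; apply: ord_geD; last exact: near_id_ge.
by apply: ord_geM => //; apply: local_endo_ge.
Qed.

(** The successive approximations converge, and the limits transform [f] into
    [F] exactly. *)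
Lemma finite_determinacy : ord_ge (L + t0) (f - F) ->
  exists phi (u : {mfps K[n]}), [/\ bijective phi, u \is a GRing.unit & F = u * phi f].
Proof.
move=> fF; have /boolp.choice [next nextP] : forall x : nat * (endo * {mfps K[n]}),
    exists st', approx x.1 x.2 -> [/\ approx x.1.+1 st',
      forall i, ord_ge x.1 (st'.1 'x_i - x.2.1 'x_i) & ord_ge x.1 (st'.2 - x.2.2)].
  by move=> [d st]; apply: approx_improve.
pose st := fix st d := if d is e.+1 then next (e, st e) else (idfun : endo, 1).
have st_approx d : approx d (st d).
  elim: d => [|d IH]; last by case: (nextP (d, st d) IH).
  split=> [i||]; rewrite /= ?subrr ?addn0 ?mul1r //; exact: ord_ge_zero.
have /boolp.choice [y yP] : forall i, exists l, forall d, ord_ge d (l - (st d).1 'x_i).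
  by move=> i; apply: limit_exists => d; case: (nextP (d, st d) (st_approx d)).
have [u uP] : exists l, forall d, ord_ge d (l - (st d).2).
  by apply: limit_exists => d; case: (nextP (d, st d) (st_approx d)).
have y2 i : ord_ge 2 (y i - 'x_i).
  rewrite -(subrKA ((st 2).1 'x_i)); apply: ord_geD => //.
  by case: (st_approx 2).
have [phi phi_y] : exists phi : endo, forall i, phi 'x_i = y i.
  apply: subst_exists => i; rewrite -[y i](subrK 'x_i); apply: ord_geD.
    exact: ord_geW (y2 i).
  exact: ord_ge_var.
have phi2 i : ord_ge 2 (phi 'x_i - 'x_i) by rewrite phi_y.
exists phi, u; split; first exact: near_id_bij.
  apply: unit_of_coef0; have : ord_ge 1 (u - 1).
    by rewrite -(subrKA (st 1).2); apply: ord_geD => //; case: (st_approx 1).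
  move=> /ord_ge_coef /(_ 0%MM); rewrite mdeg0 => /(_ isT)/eqP.
  by rewrite mfcoefB subr_eq0 => /eqP->; rewrite /= eqxx oner_neq0.
apply/esym/eqP; rewrite -subr_eq0; apply/eqP/ord_ge_eq0 => d.
have [std1 _ std] := st_approx d.
rewrite -(subrKA ((st d).2 * (st d).1 f)); apply: ord_geD; last first.
  by apply: ord_geW std; rewrite addnA leq_addl.
rewrite -(subrKA ((st d).2 * phi f)) -mulrBl -mulrBr.
apply: ord_geD; [exact: ord_geMr|apply: ord_geMl; apply: endo_congr => [||i]].
- exact: near_id_local phi2.
- exact: near_id_local std1.
- by rewrite phi_y.
Qed.
End Step.
End Determinacy.

(** * Higher Tjurina algebras determine the contact class *)

Section MatherYau.
Variables (K : fieldType) (n : nat).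
Notation endo := {lrmorphism {mfps K[n]} -> {mfps K[n]}}.
Implicit Types (p q f g : {mfps K[n]}) (phi psi theta : endo).

Lemma ord_ge_span s k f p : ord_ge s f -> tj_span 0 k.+2 f p -> ord_ge s p.
Proof.
move=> fs [a [b [_ bk ->]]]; apply: ord_geD; first exact: ord_geMl.
apply: (@ord_geW _ _ (k.+1 + s)); first exact: leq_addl.
exact: ord_ge_directional.
Qed.

Lemma ord_isP f s : ord_is f s -> ord_ge s f /\ ~ ord_ge s.+1 f.
Proof.
by move=> [/ideal_expE fs fmax]; split=> // /ideal_expE /fmax; rewrite ltnn.
Qed.

(** For [k < 2] the exponent in the bound is [s], so [f] itself would lie in the
    right-hand ideal, all of whose elements have order greater than [s]. *)
Lemma determinacy_bound_ge2 f s k : ord_ge s f -> ~ ord_ge s.+1 f ->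
  determinacy_bound f s k -> (2 <= k)%N.
Proof.
move=> fs fs1 /determinacy_boundE fL; rewrite leqNgt; apply/negP => k2; apply: fs1.
have [a [b [a1 b2 E]]] : tj_span 1 2 f f.
  apply: fL; have -> : ((k + 2 * s) %/ 2 = s)%N; last exact: fs.
  by rewrite addnC mulnC divnMDl // divn_small // addn0.
rewrite E -add1n; apply: ord_geD; first exact: ord_geM.
exact: ord_ge_directional.
Qed.

(** After lifting the isomorphism, [f1 := phi f] and [g] have the same [k]-th
    Tjurina ideal.  Then [g = a f1 + h] where [h] has order at least [k + s - 1].
    (As [k >= 2], the proof writes [k.+2] for it.)  The coefficient [a] is
    a unit, since otherwise [g], and with it the common ideal and [f1], would have
    order above [s].  Hence [g] is a unit times a perturbation of [f1] to which
    finite determinacy applies. *)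
Lemma higher_tjurina_contact f g s k : ord_ge s f -> ~ ord_ge s.+1 f -> (2 <= s)%N ->
  determinacy_bound f s k -> higher_tjurina_isom k f g -> contact_equivalent f g.
Proof.
move=> fs fs1 s2 fk; have := determinacy_bound_ge2 fs fs1 fk.
case: k fk => [|[|k]] // fk _; set L := (k./2 + s.+1)%N.
have {fk} fL : forall p, ord_ge L p -> tj_span 1 2 f p.
  move=> p pL; move/determinacy_boundE: fk; apply.
  rewrite addnC mulnC divnMDl // divn2 /= addnC addSnnS; exact: pL.
case/(@quotient_isom_lift _ _ _ _ (L + k.+2)) => [p pN|p /higher_tjurinaE|phi phib fg].
- apply/higher_tjurinaE; have [a [b [_ bk ->]]] := tj_span_mpow fL pN.
  exists a, b; split=> // i.
  by apply: ord_geW (bk i); rewrite leq_addl.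
- by move/(ord_ge_span fs); apply: ord_geW.
have [psi [psib phiK psiK]] := endo_inverse phib.
have [phi1 psi1] := (bij_local_endo phib, bij_local_endo psib).
set f1 := phi f; have f1s : ord_ge s f1 by apply: local_endo_ge.
have f1s1 : ~ ord_ge s.+1 f1.
  by move=> /(local_endo_ge psi1); rewrite phiK.
have f1L p : ord_ge L p -> tj_span 1 2 f1 p.
  move=> pL; rewrite -[p]psiK; apply: (tj_span_auto phib).
  exact/fL/local_endo_ge.
have f1g p : tj_span 0 k.+2 f1 p <-> tj_span 0 k.+2 g p.
  rewrite -(higher_tjurinaE _ g) -{1 2}[p]psiK -fg higher_tjurinaE.
  by split=> [/(tj_span_auto psib)|/(tj_span_auto phib) //]; rewrite !phiK.
have span_self q : tj_span 0 k.+2 q q.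
  by rewrite -{2}[q]mul1r; apply: tj_span_self; apply: ord_ge0.
have [a [b [_ bk gE]]] := (iffRL (f1g g) (span_self g)).
have hN : ord_ge (k.+1 + s) (directional b f1) by apply: ord_ge_directional.
have aU : a \is a GRing.unit.
  apply: unit_of_coef0; apply/eqP => a0; apply: f1s1.
  apply: (ord_ge_span _ (iffLR (f1g f1) (span_self f1))).
  rewrite gE -add1n; apply: ord_geD; last first.
    by apply: ord_geW hN; rewrite leq_add2r.
  by apply: ord_geM => //; apply: ord_ge1_coef0.
have k2 : (k./2 <= k)%N by rewrite -{2}[k]odd_double_half -addnn addnA leq_addl.
(* The order k + 1 + s of the perturbation is L + t0 for t0 = k - k./2, and
   the inequality L <= s + t0 + 1 then holds with equality for even k. *)
have [||theta [u [thb uU FE]]] := @finite_determinacy _ _ f1 s L f1s f1L (k - k./2)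
    (f1 + a^-1 * directional b f1).
- rewrite /L addnC addSnnS leq_add2l ltnS -(leq_add2r k./2) subnK //.
  by rewrite addnn -{2}[k]odd_double_half leq_addl.
- rewrite opprD addNKr; apply/ord_geN/ord_geMl; apply: ord_geW hN.
  by rewrite /L -addnA addnCA subnKC // addSn addnC.
exists (theta \o phi : endo), (a * u); split.
- exact: bij_comp.
- by rewrite unitrM aU.
by rewrite /= -/f1 -mulrA -FE mulrDr mulrA divrr // mul1r -gE.
Qed.
End MatherYau.

Theorem theorem2p2 (K : closedFieldType) (n s : nat) (f g : {mfps K[n]})
    (ord_f : ord_is f s) (s_ge2 : (2 <= s)%N) (tau_f : tjurina_finite f) :
  (contact_equivalent f g <->
     exists2 k : nat, determinacy_bound f s k & higher_tjurina_isom k f g)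
  /\
  (contact_equivalent f g <->
     forall k : nat, determinacy_bound f s k -> higher_tjurina_isom k f g).
Proof.
have [k0 fk0] := determinacy_bound_exists s tau_f.
have [fs fs1] := ord_isP ord_f.
split; split=> [fg|].
- by exists k0 => //; apply: contact_higher_tjurina.
- by case=> k fk; apply: higher_tjurina_contact fk.
- by move=> k _; apply: contact_higher_tjurina.
- by move=> /(_ k0 fk0); apply: higher_tjurina_contact fk0.
Qed.
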